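(* Let $S$ be a surface of finite type, let $0<\lambda<1/2$, and let $C_\lambda\subset S$ be the standard ternary Cantor set with parameter $\lambda$ embedded in $S$. Let $\Gamma$ be a subgroup of $\mathcal{M}^{\infty}(S,C_\lambda)$. Then one of the following holds: (1) $\Gamma$ contains a free subgroup on two generators; (2) the action of $\Gamma$ on the Cantor set $C_\lambda$ has an invariant probability measure.
   Context: Surfaces are connected and oriented. For a closed subset $K\subset S$, $\mathrm{Diff}(S,K)$ is the group of orientation-preserving $C^\infty$-diffeomorphisms $f$ of $S$ with $f(K)=K$, $\mathrm{Diff}_0(S,K)$ is its identity component, and $\mathcal{M}^{\infty}(S,K)=\mathrm{Diff}(S,K)/\mathrm{Diff}_0(S,K)$. When $K$ is a Cantor set, elements of $\mathrm{Diff}_0(S,K)$ act trivially on $K$, so $\mathcal{M}^{\infty}(S,K)$ acts on $K$ by homeomorphisms (by restriction of representatives). Probability measures are Borel. Standard ternary Cantor set with parameter $\lambda\in(0,1/2)$: start with $\mathcal I_0=\{[0,1]\}$; $\mathcal I_n$ is the collection of $2^n$ closed intervals of length $\lambda^n$ obtained by removing from each $I\in\mathcal I_{n-1}$ its open middle subinterval of length $(1-2\lambda)|I|$; the Cantor set is $\bigcap_{n\ge 0}\bigcup_{I\in\mathcal I_n}I\subset[0,1]$. It is embedded in $S$ by means of a smooth embedding of the segment $[0,1]$ in $S$, and its image in $S$ is again denoted $C_\lambda$. *)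

(* Defs.v *)
From HB Require Import structures.
From mathcomp Require Import all_boot all_order all_algebra.
From mathcomp Require Import all_classical all_reals all_analysis.

Set Implicit Arguments.
Unset Strict Implicit.
Unset Printing Implicit Defensive.

Import Order.TTheory GRing.Theory Num.Theory.
Import numFieldNormedType.Exports.

Local Open Scope classical_set_scope.
Local Open Scope ring_scope.

(* [iterD [:: v1; ...; vk] f] is D_v1 (... (D_vk f)); at a point where [f] is
   smooth it is the k-th differential of [f] evaluated on (v1, ..., vk). *)
Definition iterD {R : realType} {V W : normedModType R} (s : seq V)
    (f : V -> W) : V -> W :=
  foldr (fun v g => fun x => 'D_v g x) f s.

(* For finite-dimensional V and open U this is being of class C^oo on U:
   differentiability of all the [iterD s f] makes them continuous. *)
Definition smooth_on {R : realType} {V W : normedModType R} (U : set V)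
    (f : V -> W) : Prop :=
  forall (s : seq V) (x : V), U x -> differentiable (iterD s f) x.

(* A homeomorphism [chart_to] from an open subset of T onto an open subset of
   R^2, with inverse [chart_from]; the values of these total functions outside
   [chart_dom] and its image are irrelevant. *)
Record chart (R : realType) (T : topologicalType) := Chart {
  chart_dom : set T ;
  chart_to : T -> 'rV[R]_2 ;
  chart_from : 'rV[R]_2 -> T ;
  chart_dom_open : open chart_dom ;
  chart_img_open : open (chart_to @` chart_dom) ;
  chart_toK : forall x, chart_dom x -> chart_from (chart_to x) = x ;
  chart_to_cont : forall x, chart_dom x -> {for x, continuous chart_to} ;
  chart_from_cont : forall x, chart_dom x ->
    {for chart_to x, continuous chart_from}
}.

(* Connected smooth surfaces without boundary. The orientation is the one for
   which the charts of the (not necessarily maximal) atlas are positive. *)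
Record surface (R : realType) := Surface {
  surf_space :> topologicalType ;
  surf_hausdorff : hausdorff_space surf_space ;
  surf_second_countable : @second_countable surf_space ;
  surf_connected : connected [set: surf_space] ;
  atlas : set (chart R surf_space) ;
  atlas_cover : forall x : surf_space, exists2 c, atlas c & chart_dom c x ;
  atlas_smooth : forall c d, atlas c -> atlas d ->
    smooth_on (chart_to c @` (chart_dom c `&` chart_dom d))
              (chart_to d \o chart_from c) ;
  atlas_oriented : forall c d, atlas c -> atlas d ->
    forall x, chart_dom c x -> chart_dom d x ->
    0 < \det ('J (chart_to d \o chart_from c) (chart_to c x))
}.

Section SmoothMaps.
Context {R : realType}.
Implicit Types S T : surface R.

Definition local_rep {S T} (c : chart R S) (d : chart R T) (f : S -> T) :
    'rV[R]_2 -> 'rV[R]_2 :=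
  chart_to d \o f \o chart_from c.

(* C^oo on the open set A *)
Definition surf_smooth_on {S T} (A : set S) (f : S -> T) : Prop :=
  (forall x, A x -> {for x, continuous f}) /\
  (forall c d, atlas c -> atlas d ->
     smooth_on (chart_to c @` (A `&` chart_dom c `&` (f @^-1` chart_dom d)))
               (local_rep c d f)).

Definition orientation_preserving {S T} (f : S -> T) : Prop :=
  forall c d, atlas c -> atlas d ->
  forall x, chart_dom c x -> chart_dom d (f x) ->
  0 < \det ('J (local_rep c d f) (chart_to c x)).

Record smooth_map S T := SmoothMap {
  smooth_fun :> S -> T ;
  smooth_funP : surf_smooth_on [set: S] smooth_fun
}.

Lemma surf_smooth_id S : surf_smooth_on [set: S] (@idfun S).
Proof.
split=> [x _|c d Ac Ad s y [x [[_ cx] dx] <-]]; first exact: cvg_id.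
by apply: (atlas_smooth Ac Ad); exists x.
Qed.

Definition smooth_id S : smooth_map S S := SmoothMap (@surf_smooth_id S).

(* Subbasic neighbourhood of f for the C^oo compact-open (weak Whitney)
   topology: closeness, in charts and uniformly on the compact set K, of all
   differentials of order at most r (in operator norm). *)
Definition Cinf_nbhd {S T} (f : smooth_map S T) (c : chart R S) (d : chart R T)
    (K : set S) (r : nat) (e : R) : set (smooth_map S T) :=
  [set g : smooth_map S T | g @` K `<=` chart_dom d /\
    forall x, K x -> forall s : seq 'rV[R]_2, (size s <= r)%N ->
    (forall v, v \in s -> `|v| <= 1) ->
    `|iterD s (local_rep c d g) (chart_to c x) -
      iterD s (local_rep c d f) (chart_to c x)| < e].

Definition Cinf_subbase S T : set (set (smooth_map S T)) :=
  [set N | exists (f : smooth_map S T) c d K r e,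
    [/\ atlas c /\ atlas d, compact K, K `<=` chart_dom c,
        f @` K `<=` chart_dom d & 0 < e /\ N = Cinf_nbhd f c d K r e]].

HB.instance Definition _ S T := gen_eqMixin (smooth_map S T).
HB.instance Definition _ S T := gen_choiceMixin (smooth_map S T).
HB.instance Definition _ S T := @isSubBaseTopological.Build (smooth_map S T)
  (set (smooth_map S T)) (@Cinf_subbase S T) id.

(* S is diffeomorphic to a closed surface minus a finite set. *)
Definition finite_type S : Prop :=
  exists (M : surface R) (F : set M) (e : S -> M) (e' : M -> S),
    [/\ compact [set: M] /\ finite_set F,
        surf_smooth_on [set: S] e /\ surf_smooth_on (~` F) e',
        forall x, (~` F) (e x),
        forall x, e' (e x) = x &
        forall y, (~` F) y -> e (e' y) = y].

End SmoothMaps.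

Section MappingClassGroup.
Context {R : realType} {S : surface R}.
Implicit Types (K : set S) (A B : set (smooth_map S S)).

Definition Diff K : set (smooth_map S S) :=
  [set f | [/\ exists g : smooth_map S S, cancel f g /\ cancel g f,
               orientation_preserving f & f @` K = K]].

Definition Diff0 K : set (smooth_map S S) :=
  connected_component (Diff K) (smooth_id S).

Definition setcomp A B : set (smooth_map S S) :=
  [set h | exists f g : smooth_map S S, [/\ A f, B g & h = f \o g :> (S -> S)]].

Definition setinv A : set (smooth_map S S) :=
  [set h | exists2 f : smooth_map S S, A f & cancel f h /\ cancel h f].

(* The quotient group Diff(S,K) / Diff_0(S,K): its elements are the cosets of
   Diff_0(S,K), multiplied by [setcomp] and inverted by [setinv], with unit
   [Diff0 K]. *)
Definition mcg K : set (set (smooth_map S S)) :=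
  [set setcomp [set f] (Diff0 K) | f in Diff K].

Definition mcg_subgroup K (G : set (set (smooth_map S S))) : Prop :=
  [/\ G `<=` mcg K, G (Diff0 K),
      forall A B, G A -> G B -> G (setcomp A B) &
      forall A, G A -> G (setinv A)].

(* Words in a, b, a^-1, b^-1: in a letter (i, j), i selects the generator and
   j tells whether it is inverted. *)
Definition reduced_word (w : seq (bool * bool)) : bool :=
  sorted (fun k l => ~~ ((k.1 == l.1) && (k.2 != l.2))) w.

Definition eval_letter A B (l : bool * bool) : set (smooth_map S S) :=
  let X := if l.1 then A else B in if l.2 then setinv X else X.

Definition eval_word K A B (w : seq (bool * bool)) : set (smooth_map S S) :=
  foldr (fun l X => setcomp (eval_letter A B l) X) (Diff0 K) w.

Definition free_pair K A B : Prop :=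
  forall w, reduced_word w -> w != [::] -> eval_word K A B w <> Diff0 K.

Definition contains_free_group2 K (G : set (set (smooth_map S S))) : Prop :=
  exists A B, [/\ G A, G B & free_pair K A B].

End MappingClassGroup.

(* T together with the default point that measurable types must carry *)
Definition pointed_at {T : topologicalType} (x0 : T) : Type := T.

HB.instance Definition _ (T : topologicalType) (x0 : T) :=
  Topological.on (pointed_at x0).
HB.instance Definition _ (T : topologicalType) (x0 : T) :=
  isPointed.Build (pointed_at x0) x0.

Definition borel {T : topologicalType} (x0 : T) :=
  g_sigma_algebraType (@open (pointed_at x0)).

(* K, as a type, has the subspace topology. The set of points of K displayed
   below is the preimage of X under the restriction of f to K. *)
Definition has_invariant_probability {R : realType} {S : surface R} (K : set S)
    (G : set (set (smooth_map S S))) : Prop :=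
  exists (x0 : K) (mu : probability (borel x0) R),
    forall A, G A -> forall f : smooth_map S S, A f ->
    forall X : set (borel x0), measurable X ->
    mu [set x : K | exists2 y : K, f (val x) = val y & X y] = mu X.

Section Cantor.
Context {R : realType}.

(* An interval [u, v] is represented by the pair (u, v). *)
Fixpoint cantor_intervals (lam : R) (n : nat) : seq (R * R) :=
  if n is m.+1 then
    flatten [seq [:: (J.1, J.1 + lam * (J.2 - J.1));
                     (J.2 - lam * (J.2 - J.1), J.2)]
            | J <- cantor_intervals lam m]
  else [:: (0, 1)].

Definition cantor (lam : R) : set R :=
  \bigcap_n \bigcup_(J in [set` cantor_intervals lam n]) [set` `[J.1, J.2]].

(* Smooth embedding of [0,1] (an injective immersion, by compactness),
   given by a smooth extension to an open neighbourhood of [0,1]. *)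
Definition smooth_segment {S : surface R} (g : R -> S) : Prop :=
  exists2 e : R, 0 < e &
  [/\ forall t, t \in `]- e, 1 + e[ -> {for t, continuous g},
      forall c, atlas c ->
        smooth_on ([set` `]- e, 1 + e[] `&` (g @^-1` chart_dom c)) (chart_to c \o g),
      {in `[0, 1] &, injective g} &
      forall c, atlas c -> forall t, t \in `[0, 1] -> chart_dom c (g t) ->
        'D_1 (chart_to c \o g) t != 0].

End Cantor.

(* Main.v *)
(* The Cantor set is coded by binary sequences. A diffeomorphism preserving it
   has, along it, a derivative that is continuous and nonzero; as the gaps of the
   Cantor set only have lengths [(1 - 2 lam) lam^k], the induced map of binary
   sequences is locally of the form [v.y |-> w.y] or [v.y |-> w.(not y)], that is,
   it belongs to a signed Thompson group [V]. Since the Cantor set is totally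
   disconnected, [Diff0] fixes it pointwise, so [Gamma] acts through such maps.

   Let [G] be generated by finitely many of these maps. Every [h] in [G] has a
   power which is the identity on the set [U_h] of its locally periodic points,
   and off [U_h] it has north-south dynamics with finitely many attracting and
   repelling points. If some point lies in [U_h] for all [h], its orbit is
   finite: otherwise some word would move it between very different scales, and
   the pigeonhole principle would extract from that word an [h] contracting a
   neighbourhood of an orbit point strictly into itself. If no such point exists,
   finitely many complements of sets [U_h] cover the Cantor set, and a product of
   high powers of the corresponding [h] contracts everything but a neighbourhood
   of a finite set to a neighbourhood of a finite set. If moreover there is no
   finite orbit, Neumann's lemma moves these finite sets off themselves and the
   ping-pong lemma gives a free group. So if [Gamma] has no free subgroup, its
   finitely generated subgroups have finite orbits, and an ultralimit of the
   uniform measures on these orbits is an invariant probability measure. *)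

Require Import Defs.
From HB Require Import structures.
From mathcomp Require Import all_boot all_order all_algebra.
From mathcomp Require Import all_classical all_reals all_analysis.
From mathcomp Require Import zify lra finmap.

Set Implicit Arguments.
Unset Strict Implicit.
Unset Printing Implicit Defensive.

Local Open Scope classical_set_scope.
Local Open Scope nat_scope.

(** * Maps of binary sequences that are locally prefix replacements *)

Definition bits := nat -> bool.

Definition pre (n : nat) (x : bits) : seq bool := mkseq x n.

Definition catb (v : seq bool) (y : bits) : bits :=
  fun i => if i < size v then nth false v i else y (i - size v).

Definition shift (n : nat) (x : bits) : bits := fun i => x (n + i).

Definition xb (e : bool) (y : bits) : bits := fun i => e (+) y i.

(* [h] maps the cylinder of [v] onto that of [w] by an affine map of the
   corresponding pieces of the Cantor set; complementing all the remaining bits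
   ([e = true]) amounts to reversing the orientation. *)
Definition aff (h : bits -> bits) (v w : seq bool) : Prop :=
  exists e, forall y, h (catb v y) = catb w (xb e y).

Lemma size_pre n x : size (pre n x) = n.
Proof. exact: size_mkseq. Qed.

Lemma nth_pre n x i : i < n -> nth false (pre n x) i = x i.
Proof. exact: nth_mkseq. Qed.

Lemma pre_eqP n x y : pre n x = pre n y <-> (forall i, i < n -> x i = y i).
Proof.
split=> [E i lin|E]; first by rewrite -(nth_pre x lin) E nth_pre.
apply: (@eq_from_nth _ false); rewrite !size_pre // => i lin.
by rewrite !nth_pre //; exact: E.
Qed.

Lemma bits_eq (x y : bits) : (forall n, pre n x = pre n y) -> x = y.
Proof. by move=> E; apply/funext => i; apply: (pre_eqP i.+1 x y).1. Qed.

Lemma pre_le m n x y : m <= n -> pre n x = pre n y -> pre m x = pre m y.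
Proof.
by move=> lemn /pre_eqP E; apply/pre_eqP => i ltim; apply: E; lia.
Qed.

Lemma catbA u v y : catb (u ++ v) y = catb u (catb v y).
Proof.
apply/funext => i; rewrite /catb size_cat nth_cat.
case: (ltnP i (size u)) => h1; first by rewrite ltn_addr.
rewrite -ltn_subLR //; case: ltnP => // _; by rewrite subnDA.
Qed.

Lemma catb_pre n x : catb (pre n x) (shift n x) = x.
Proof.
apply/funext => i; rewrite /catb size_pre /shift; case: ltnP => h.
  by rewrite nth_pre.
by rewrite subnKC.
Qed.

Lemma pre_catb v y : pre (size v) (catb v y) = v.
Proof.
apply: (@eq_from_nth _ false); rewrite size_pre // => i h.
by rewrite nth_pre // /catb h.
Qed.

Lemma pre_catbW n v y : n <= size v -> pre n (catb v y) = take n v.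
Proof.
move=> h; apply: (@eq_from_nth _ false); rewrite size_pre ?size_takel // => i hi.
by rewrite nth_pre // /catb (leq_trans hi h) nth_take.
Qed.

Lemma pre_catb_ge v y k : pre (size v + k) (catb v y) = v ++ pre k y.
Proof.
apply: (@eq_from_nth _ false); rewrite ?size_cat !size_pre // => i hi.
rewrite nth_pre // /catb nth_cat; case: ltnP => // h; rewrite nth_pre //; lia.
Qed.

Lemma pre_cat_ex n k x : exists2 s, size s = k & pre (n + k) x = pre n x ++ s.
Proof.
exists (pre k (shift n x)); first exact: size_pre.
by rewrite -{1}(catb_pre n x) -{1}(size_pre n x) pre_catb_ge.
Qed.

Lemma pre_take m n x : m <= n -> take m (pre n x) = pre m x.
Proof.
move=> lemn; apply: (@eq_from_nth _ false).
  by rewrite size_takel size_pre.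
move=> i; rewrite size_takel ?size_pre // => hi.
by rewrite nth_take // !nth_pre // (leq_trans hi).
Qed.

Lemma xbK e : involutive (xb e).
Proof. by move=> y; apply/funext => i; rewrite /xb addbA addbb. Qed.

Lemma xbD e e' y : xb e (xb e' y) = xb (e (+) e') y.
Proof. by apply/funext => i; rewrite /xb addbA. Qed.

Lemma xb0 y : xb false y = y.
Proof. by apply/funext => i; rewrite /xb. Qed.

Lemma xb_catb e s y : xb e (catb s y) = catb (map (addb e) s) (xb e y).
Proof.
apply/funext => i; rewrite /xb /catb size_map; case: ltnP => // h.
by rewrite (nth_map false).
Qed.

Section Aff.
Implicit Types (h k : bits -> bits) (v w u s : seq bool).

Lemma aff_id v : aff id v v.
Proof. by exists false => y; rewrite xb0. Qed.

Lemma aff_comp h k v u w : aff h v u -> aff k u w -> aff (k \o h) v w.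
Proof.
move=> [e he] [e' he']; exists (e' (+) e) => y.
by rewrite /= he he' xbD.
Qed.

Lemma aff_catE h v w : aff h v w ->
  exists e, forall s, aff h (v ++ s) (w ++ map (addb e) s).
Proof.
move=> [e he]; exists e => s; exists e => y.
by rewrite !catbA he xb_catb.
Qed.

Lemma aff_cat h v w s : aff h v w ->
  exists2 s', size s' = size s & aff h (v ++ s) (w ++ s').
Proof.
by move=> /aff_catE[e he]; exists (map (addb e) s); rewrite ?size_map.
Qed.

Lemma aff_inv h k v w : cancel h k -> aff h v w -> aff k w v.
Proof.
move=> hK [e he]; exists e => y.
by rewrite -[X in xb e X](xbK e) xbK -[in LHS](xbK e y) -he hK.
Qed.

(** If [w] were the shorter one, the bit at position [size w] of the image would be a fixed letter
    of [w'], yet it takes both values on the two constant continuations. *)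
Lemma aff_size h v w w' : aff h v w -> aff h v w' -> size w = size w'.
Proof.
wlog le : w w' / size w <= size w'.
  move=> H a b; case: (leqP (size w) (size w')) => [l|/ltnW l]; first exact: H.
  by apply/esym; apply: H.
move=> [e he] [e' he']; apply/eqP; rewrite eqn_leq le /= leqNgt; apply/negP => lt.
pose c b : bits := fun=> b.
have E b : catb w (xb e (c b)) (size w) = catb w' (xb e' (c b)) (size w).
  by rewrite -he he'.
have := E true; have := E false.
by rewrite /catb lt ltnn => <-; case: (e).
Qed.

Lemma aff_fun h v w w' : aff h v w -> aff h v w' -> w = w'.
Proof.
move=> a b; have sz := aff_size a b; case: a b => [e he] [e' he'].
have := he (fun=> false); rewrite he' => E.
by rewrite -(pre_catb w (xb e (fun=> false))) -E sz pre_catb.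
Qed.

Lemma aff_injl h v v' w : injective h -> aff h v w -> aff h v' w -> v = v'.
Proof.
move=> hi [e he] [e' he'].
have E y : catb v (xb e y) = catb v' (xb e' y).
  by apply: hi; rewrite he he' !xbK.
have av : aff id v v' by exists (e' (+) e) => y; rewrite -[y in LHS](xbK e) E xbD.
exact: aff_fun (aff_id v) av.
Qed.

Lemma aff_pre h v w x : aff h v w -> pre (size v) x = v -> pre (size w) (h x) = w.
Proof. by move=> [e he] E; rewrite -(catb_pre (size v) x) E he pre_catb. Qed.

End Aff.

(** * Locally affine maps and compactness of the Cantor space *)

Definition treelike (h : bits -> bits) : Prop :=
  forall x, exists n w, aff h (pre n x) w.

(** One step down the binary tree inside [P]; the right child is a default, legitimate only when one
    of the two children satisfies [P]. *)
Definition nxt (P : seq bool -> Prop) (v : seq bool) : seq bool :=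
  if `[< P (rcons v false) >] then rcons v false else rcons v true.

(** Konig's lemma, the form in which compactness is used throughout. If no bound holds at the root,
    every vertex without a bound has a child without one; the branch so obtained has a prefix
    satisfying [P], and there heredity makes 0 a bound. *)
Lemma konig (P : seq bool -> Prop) :
  (forall v s, P v -> P (v ++ s)) -> (forall x, exists n, P (pre n x)) ->
  exists N, forall v, N <= size v -> P v.
Proof.
move=> ext ex.
pose good v := exists N, forall s, N <= size s -> P (v ++ s).
have step v : good (rcons v false) -> good (rcons v true) -> good v.
  move=> [N1 h1] [N2 h2]; exists (maxn N1 N2).+1 => -[|b s] //= hs.
  rewrite -cat_rcons; case: b; [apply: h2|apply: h1]; lia.
apply: contrapT => nogood.
have ng0 : ~ good [::] by move=> [N hN]; apply: nogood; exists N => v /hN.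
pose V n := iter n (nxt (fun v => ~ good v)) [::].
have ngV n : ~ good (V n).
  elim: n => //= n IH; rewrite /nxt; case: asboolP => // /contrapT g0 g1.
  exact: IH (step _ g0 g1).
have sV n : size (V n) = n.
  by elim: n => //= n IH; rewrite /nxt; case: asboolP => _; rewrite size_rcons IH.
pose x : bits := fun n => last false (V n.+1).
have Vx n : V n = pre n x.
  elim: n => // n IH; rewrite /pre /mkseq -addn1 iotaD map_cat -/(mkseq x n) -/(pre n x).
  rewrite -IH add0n /= cats1 /x /= addn1 /= /nxt; case: asboolP => _;
  by rewrite last_rcons.
have [n Pn] := ex x; apply: (ngV n); exists 0 => s _; rewrite Vx; exact: ext.
Qed.

Lemma treelike_unif h : treelike h ->
  exists N, forall v, N <= size v -> exists w, aff h v w.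
Proof.
move=> tl; apply: konig => [v s [w /(aff_cat s)[s' _ a]]|x]; first by eexists; eauto.
by have [n [w a]] := tl x; exists n, w.
Qed.

Lemma treelike_id : treelike id.
Proof. by move=> x; exists 0, [::]; exact: aff_id. Qed.

Lemma treelike_comp h k : treelike h -> treelike k -> treelike (k \o h).
Proof.
move=> th /treelike_unif[N hN] x; have [n [w a]] := th x.
have [s ss E] := pre_cat_ex n N x; exists (n + N); rewrite E.
have [s' ss' a'] := aff_cat s a.
have [|u au] := hN (w ++ s'); first by rewrite size_cat ss' ss leq_addl.
exists u; exact: aff_comp a' au.
Qed.

Lemma treelike_continuous h m : treelike h ->
  exists n, forall x y, pre n x = pre n y -> pre m (h x) = pre m (h y).
Proof.
move=> /treelike_unif[N hN]; exists (N + m) => x y E.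
have E' : pre N x = pre N y by apply: pre_le E; rewrite leq_addr.
have [|w [e he]] := hN (pre N x); first by rewrite size_pre.
rewrite -(catb_pre N x) -(catb_pre N y) -E' !he.
apply: (pre_le (leq_addl (size w) m)); rewrite !pre_catb_ge; congr (_ ++ _).
apply/pre_eqP => i hi; congr (_ (+) _); rewrite /shift.
by apply: (pre_eqP _ _ _).1 E _ _; rewrite ltn_add2l.
Qed.

(** * Dynamics of a single map *)

(* Unlike [aff (iter k h) v w], this asks that every intermediate image of the
   cylinder of [v] be a cylinder. *)
Fixpoint reach (h : bits -> bits) (k : nat) (v w : seq bool) : Prop :=
  if k is k'.+1 then exists2 u, aff h v u & reach h k' u w else v = w.

Definition stab h v := forall k, exists w, reach h k v w.

Definition periodic h v := exists2 k, 0 < k & reach h k v v.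

Definition verts (L : nat) : seq (seq bool) := [seq val t | t <- enum {:L.-tuple bool}].

Definition near (n : nat) (F : seq bits) (x : bits) : Prop :=
  exists2 a, a \in F & pre n a = pre n x.

Definition unstable h x := forall n, ~ stab h (pre n x).

Definition loc_periodic h x := exists n, periodic h (pre n x).

Lemma mem_verts v : v \in verts (size v).
Proof. by apply/mapP; exists (in_tuple v); rewrite ?mem_enum. Qed.

Lemma verts_pre L x : pre L x \in verts L.
Proof. by rewrite -[X in verts X](size_pre L x) mem_verts. Qed.

Lemma mem_vertsP L v : v \in verts L -> size v = L.
Proof. by move=> /mapP[t _ ->]; rewrite size_tuple. Qed.

Lemma unif_seq (T : eqType) (l : seq T) (P : T -> nat -> Prop) :
  (forall v, v \in l -> exists K, forall k, K <= k -> P v k) ->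
  exists K, forall v, v \in l -> forall k, K <= k -> P v k.
Proof.
elim: l => [|a l IH] H; first by exists 0.
have [K1 h1] := H a (mem_head _ _).
have [|K2 h2] := IH; first by move=> v hv; apply: H; rewrite in_cons hv orbT.
exists (maxn K1 K2) => v; rewrite in_cons => /orP[/eqP ->|hv] k; rewrite geq_max => /andP[l1 l2].
  exact: h1.
exact: h2.
Qed.

Lemma inj_avoid (T : eqType) (f : nat -> T) (l : seq T) : injective f ->
  exists K, forall k, K <= k -> f k \notin l.
Proof.
move=> fi; have [v _|K hK] := @unif_seq _ l (fun v k => f k != v).
  case: (pselect (exists k, f k = v)) => [[k0 <-]|n].
    by exists k0.+1 => k lk; apply/eqP => /fi E; lia.
  by exists 0 => k _; apply/eqP => E; apply: n; exists k.
by exists K => k lk; apply/negP => hin; have /eqP := hK _ hin k lk.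
Qed.

Definition verts_lt (L : nat) := flatten [seq verts i | i <- iota 0 L].

Lemma mem_verts_lt L v : size v < L -> v \in verts_lt L.
Proof.
move=> h; apply/flatten_mapP; exists (size v); last exact: mem_verts.
by rewrite mem_iota.
Qed.

Lemma nested_limit (V : nat -> seq bool) :
  (forall q, exists2 s, s <> [::] & V q.+1 = V q ++ s) ->
  exists p, forall q, pre (size (V q)) p = V q.
Proof.
move=> H.
have szV q : q <= size (V q).
  elim: q => // q IH; have [[//|b s] _ ->] := H q; rewrite size_cat /=; lia.
have mono q r i : q <= r -> i < size (V q) -> nth false (V r) i = nth false (V q) i.
  move=> /subnK <-; elim: (r - q) => // m IH hi; rewrite addSn.
  have [s _ ->] := H (m + q); rewrite nth_cat -IH //; case: ltnP => // c.
  have : size (V q) <= size (V (m + q)).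
    elim: (m) => // m' IHm; rewrite addSn; have [s' _ ->] := H (m' + q).
    by rewrite size_cat; lia.
  lia.
(* [V i.+1] has at least [i.+1] letters, so the default of [nth] is never read. *)
exists (fun i => nth false (V i.+1) i) => q.
apply: (@eq_from_nth _ false); rewrite size_pre // => i hi; rewrite nth_pre //.
case: (leqP q i.+1) => c; first by rewrite (mono q).
by rewrite (mono i.+1 q i) // ltnW.
Qed.

Section Reach.
Implicit Types (h g : bits -> bits) (v w u s : seq bool).

Lemma reach_aff h k v w : reach h k v w -> aff (iter k h) v w.
Proof.
elim: k v => [|k IH] v /=; first by move=> ->; exact: aff_id.
move=> [u a /IH b]; have := aff_comp a b; congr aff.
by apply/funext => x /=; rewrite -iterSr.
Qed.

Lemma reach_fun h k v w w' : reach h k v w -> reach h k v w' -> w = w'.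
Proof. by move=> /reach_aff a /reach_aff b; exact: aff_fun a b. Qed.

Lemma reach_injl h k v v' w : injective h ->
  reach h k v w -> reach h k v' w -> v = v'.
Proof.
move=> hi /reach_aff a /reach_aff b; apply: (aff_injl _ a b).
by elim: k {a b} => //= k IH x y /hi /IH.
Qed.

Lemma reach_catE h k v w : reach h k v w ->
  exists e, forall s, reach h k (v ++ s) (w ++ map (addb e) s).
Proof.
elim: k v => [|k IH] v /=.
  by move=> ->; exists false => s; rewrite map_id.
move=> [u /aff_catE[e a] /IH[e' b]]; exists (e' (+) e) => s.
exists (u ++ map (addb e) s) => //; have := b (map (addb e) s).
by rewrite -map_comp; congr reach; congr (_ ++ _); apply: eq_map => c /=; rewrite addbA.
Qed.

Lemma reach_cat h k v w s : reach h k v w ->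
  exists2 s', size s' = size s & reach h k (v ++ s) (w ++ s').
Proof.
by move=> /reach_catE[e he]; exists (map (addb e) s); rewrite ?size_map.
Qed.

Lemma reach_add h k l v w :
  reach h (k + l) v w <-> exists2 u, reach h k v u & reach h l u w.
Proof.
elim: k v => [|k IH] v /=.
  by split=> [r|[u -> //]]; exists v.
split=> [[u a /IH[u' b c]]|[u' [u a b] c]]; first by exists u' => //; exists u.
by exists u => //; apply/IH; exists u'.
Qed.

Lemma reach_rev h g k v w : cancel h g -> reach h k v w -> reach g k w v.
Proof.
move=> hK; elim: k v w => [|k IH] v w; first by move=> /= ->.
move=> [u a /IH b]; rewrite -addn1; apply/reach_add; exists u => //.
by exists v => //; exact: aff_inv a.
Qed.

Lemma stab_cat h v s : stab h v -> stab h (v ++ s).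
Proof. by move=> st k; have [w /(reach_cat s)[s' _ r]] := st k; eexists; eauto. Qed.

Lemma stab_pre h m n x : m <= n -> stab h (pre m x) -> stab h (pre n x).
Proof.
by move=> le; have [s _] := pre_cat_ex m (n - m) x; rewrite subnKC // => ->; exact: stab_cat.
Qed.

Lemma loop_stab h d v s : 0 < d -> reach h d v (v ++ s) -> stab h v.
Proof.
move=> d0 r k.
have [w] : exists w, reach h (k * d) v w.
  elim: k => [|k [w IH]]; first by exists v.
  have [s' _ r'] := reach_cat s IH.
  by exists (w ++ s'); rewrite mulSn; apply/reach_add; exists (v ++ s).
have [m ->] : exists m, k * d = k + m by exists (k * d - k); nia.
by move=> /reach_add[u r' _]; exists u.
Qed.

(** A vertex met twice would, by injectivity of [h], make [v] periodic. So the vertices of the orbit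
    are distinct and eventually avoid the finitely many short ones. *)
Lemma stab_deep h v L : injective h -> stab h v -> ~ periodic h v ->
  exists K, forall k, K <= k -> forall w, reach h k v w -> L <= size w.
Proof.
move=> hi st np; have [f hf] := choice st.
have fi : injective f.
  move=> k l; wlog lt : k l / k < l.
    move=> H E; case: (ltngtP k l) => // c; first exact: H.
    by apply/esym; apply: H.
  move=> E; exfalso; apply: np; exists (l - k); first lia.
  have := hf l; rewrite -(subnK (ltnW lt)) => /reach_add[u r1 r2].
  by move: r2; rewrite subnK ?(ltnW lt) // -E => r2; rewrite -{2}(reach_injl hi r2 (hf k)).
have [K hK] := inj_avoid (verts_lt L) fi; exists K => k lk w r.
rewrite leqNgt; apply/negP => /mem_verts_lt hw.
by have := hK _ lk; rewrite (reach_fun (hf k) r) hw.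
Qed.

Lemma periodic_cat h v s : periodic h v -> periodic h (v ++ s).
Proof.
(* One turn of the cycle may complement the bits after [v]; a second turn restores them. *)
move=> [k k0 /reach_catE[e r]]; exists (k + k); first lia.
apply/reach_add; exists (v ++ map (addb e) s); first exact: r.
have := r (map (addb e) s); rewrite -map_comp; congr reach; congr (_ ++ _).
by rewrite -[RHS]map_id; apply: eq_map => c /=; rewrite addbA addbb.
Qed.

Lemma periodic_pre h m n x : m <= n -> periodic h (pre m x) -> periodic h (pre n x).
Proof.
by move=> le; have [s _] := pre_cat_ex m (n - m) x; rewrite subnKC // => ->; exact: periodic_cat.
Qed.

Lemma periodic_uncat h v s : stab h v -> periodic h (v ++ s) -> periodic h v.
Proof.
move=> st [k k0 r]; exists k => //; have [w rw] := st k.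
have [s' ss r'] := reach_cat s rw; have /eqP := reach_fun r r'.
have := congr1 size (reach_fun r r'); rewrite !size_cat ss => /addIn E.
rewrite eqseq_cat //.
by move=> /andP[/eqP ev _]; rewrite {2}ev.
Qed.

Lemma loc_periodic_stab h n x : loc_periodic h x -> stab h (pre n x) -> periodic h (pre n x).
Proof.
move=> [m p] st; have p' := periodic_pre (leq_maxr n m) p.
have [s _] := pre_cat_ex n (maxn n m - n) x; rewrite subnKC ?leq_maxl // => E.
by move: p'; rewrite E; exact: periodic_uncat.
Qed.

Lemma periodic_id h p n x : reach h p (pre n x) (pre n x) -> iter (p + p) h x = x.
Proof.
move=> /reach_aff[e he]; rewrite ssrnat.iterD -{1}(catb_pre n x) he he xbD addbb xb0.
exact: catb_pre.
Qed.

End Reach.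

Section Dynamics.
Variables h g : bits -> bits.
Hypotheses (hK : cancel h g) (gK : cancel g h).
Hypotheses (th : treelike h) (tg : treelike g).

Let hi : injective h := can_inj hK.

Definition exits v e := (exists k, reach h k v e) /\ ~ exists u, aff h e u.

Lemma exit_ex v : ~ stab h v -> exists e, exits v e.
Proof.
move=> ns; apply: contrapT => ne; apply: ns; elim=> [|k [w r]]; first by exists v.
have [u a] : exists u, aff h w u.
  by apply: contrapT => nu; apply: ne; exists w; split=> //; exists k.
by exists u; rewrite -addn1; apply/reach_add; exists w => //; exists u.
Qed.

(** Otherwise cancelling the last [k'] steps gives a path from [v] to its proper descendant
    [v ++ s]; such a loop makes [v] stable, and its orbit would continue beyond [e]. *)
Lemma exit_lt k k' v s e : s <> [::] -> ~ (exists u, aff h e u) ->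
  reach h k v e -> reach h k' (v ++ s) e -> k < k'.
Proof.
move=> s0 ne r r'; rewrite ltnNge; apply/negP => le.
move: (r); rewrite -(subnK le) => /reach_add[u r1 r2].
have E := reach_injl hi r2 r'; rewrite {u r2}E in r1.
case: (posnP (k - k')) => [z|p].
  move: r1; rewrite z /= => E; apply: s0; apply/nilP.
  by have := congr1 size E; rewrite size_cat /nilp; lia.
have [w] := loop_stab p r1 k.+1; rewrite -addn1 => /reach_add[u r3 [w' a _]].
by apply: ne; rewrite (reach_fun r r3); exists w'.
Qed.

(** Exits are shorter than the uniform depth [N], so there are finitely many of them, and one [e]
    serves arbitrarily long prefixes of [x]. *)
Lemma unstable_exit x : unstable h x -> exists e, (~ exists u, aff h e u) /\
  forall n, exists2 j, n <= j & exists k, reach h k (pre j x) e.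
Proof.
move=> bx; have [N hN] := treelike_unif th.
apply: contrapT => H.
have [|n Hn] := @unif_seq _ (verts_lt N) (fun e j => ~ exits (pre j x) e).
  move=> e _; apply: contrapT => H'; apply: H; exists e; split.
    move=> [u a]; apply: H'; exists 0 => k _ [_]; apply; by exists u.
  move=> n; apply: contrapT => H''; apply: H'; exists n => k lk [[m r] _].
  by apply: H''; exists k => //; exists m.
have [e ex] := exit_ex (bx n); apply: (Hn e _ n) => //.
apply: mem_verts_lt; rewrite ltnNge; apply/negP => /hN; by case: ex.
Qed.

(** Two prefixes of [x] of different lengths leave at [e], the longer one later. During the time
    difference [d] the longer is carried onto the shorter, so [d] steps of [g] contract the shorter
    into itself. *)
Lemma unstable_loop x e : (~ exists u, aff h e u) ->
  (forall n, exists2 j, n <= j & exists k, reach h k (pre j x) e) ->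
  exists j k d s, [/\ 0 < d, s <> [::], reach h k (pre j x) e &
    reach g d (pre j x) (pre j x ++ s)].
Proof.
move=> ne H; have [j _ [k r]] := H 0; have [j' lj [k' r']] := H j.+1.
have [s ss E] := pre_cat_ex j (j' - j) x; rewrite subnKC ?(ltnW lj) // in E.
have s0 : s <> [::] by move=> s0; rewrite s0 /= in ss; lia.
rewrite E in r'; have lt := exit_lt s0 ne r r'.
exists j, k, (k' - k), s; split => //; first lia.
apply: (reach_rev hK); move: r'; rewrite -{1}(subnK (ltnW lt)) => /reach_add[u r1 r2].
by rewrite -(reach_injl hi r r2) in r1.
Qed.

Lemma unstable_stab_inv x : unstable h x -> exists n, stab g (pre n x).
Proof.
move=> /unstable_exit[e [ne H]]; have [j [k [d [s [d0 _ _ r]]]]] := unstable_loop ne H.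
by exists j; exact: loop_stab d0 r.
Qed.

Lemma exit_unbounded x e : (~ exists u, aff h e u) ->
  (forall n, exists2 j, n <= j & exists k, reach h k (pre j x) e) ->
  forall n m, exists j k, [/\ n <= j, m <= k & reach h k (pre j x) e].
Proof.
move=> ne H n; elim=> [|m [j [k [lj lk r]]]].
  by have [j lj [k r]] := H n; exists j, k.
have [j' lj' [k' r']] := H j.+1; exists j', k'; split=> //; first lia.
apply: leq_ltn_trans lk _.
have [s ss E] := pre_cat_ex j (j' - j) x; rewrite subnKC ?(ltnW lj') // in E.
apply: (@exit_lt _ _ (pre j x) s e) => //; last by rewrite -E.
by move=> s0; rewrite s0 /= in ss; lia.
Qed.

(* The backward orbit of [e] is eventually a union of [d] nested sequences of
   cylinders, which shrink to the orbit of a periodic point [p] of [g]. *)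
Lemma unstable_exit_finite e : (~ exists u, aff h e u) -> exists F : seq bits,
  forall x, (forall n, exists2 j, n <= j & exists k, reach h k (pre j x) e) ->
  x \in F.
Proof.
move=> ne.
case: (pselect (exists x0, forall n, exists2 j, n <= j &
         exists k, reach h k (pre j x0) e)); last first.
  by move=> H; exists [::] => x Hx; exfalso; apply: H; exists x.
move=> [x0 H0]; have [j0 [k0 [d [s [d0 s0 r0 rl]]]]] := unstable_loop ne H0.
have /choice[V rV] q := loop_stab d0 rl (q * d).
have [p hp] : exists p, forall q, pre (size (V q)) p = V q.
  apply: nested_limit => q; have [s' ss' r'] := reach_cat s (rV q).
  exists s'; first by move=> E; apply: s0; apply/nilP; rewrite /nilp -ss' E.
  apply: reach_fun (rV q.+1) _; rewrite mulSn; apply/reach_add.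
  by exists (pre j0 x0 ++ s).
exists [seq iter r g p | r <- iota 0 d] => y Hy; apply: contrapT => nin.
have [|n Hn] := @unif_seq _ (iota 0 d) (fun r n => pre n (iter r g p) <> pre n y).
  move=> r hr; apply: contrapT => H; apply: nin; apply/mapP; exists r => //.
  apply: bits_eq => n; apply: contrapT => H'; apply: H; exists n => k lk /(pre_le lk) E.
  by apply: H'; rewrite E.
have [j [k [lj lk r]]] := exit_unbounded ne Hy n k0.
set q := (k - k0) %/ d; set t := (k - k0) %% d.
have Ek : k = k0 + (q * d + t) by rewrite -divn_eq subnKC.
have ht : t \in iota 0 d by rewrite mem_iota /= add0n ltn_mod.
apply: (Hn t ht j lj).
have := reach_rev hK r; rewrite Ek => /reach_add[u r1 /reach_add[v r2 r3]].
rewrite -(reach_fun (reach_rev hK r0) r1) in r2.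
rewrite -(reach_fun (rV q) r2) in r3.
by have := aff_pre (reach_aff r3) (hp q); rewrite size_pre.
Qed.

Lemma unstable_finite : exists R : seq bits, forall x, unstable h x <-> x \in R.
Proof.
have [N hN] := treelike_unif th.
have /choice[f hf] (e : seq bool) : exists F : seq bits,
    (~ exists u, aff h e u) -> forall x,
    (forall n, exists2 j, n <= j & exists k, reach h k (pre j x) e) -> x \in F.
  case: (pselect (exists u, aff h e u)) => [ex|ne]; first by exists [::] => /(_ ex).
  by have [F hF] := unstable_exit_finite ne; exists F.
exists [seq x <- flatten [seq f e | e <- verts_lt N] | `[< unstable h x >]] => x.
rewrite mem_filter; split=> [b|/andP[/asboolP //]].
apply/andP; split; first exact/asboolP.
have [e [ne He]] := unstable_exit b; apply/flatten_mapP; exists e; last exact: hf.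
by apply: mem_verts_lt; rewrite ltnNge; apply/negP => /hN.
Qed.

Lemma unstable_step x : unstable h x -> unstable h (h x).
Proof.
move=> bx n st; have [N hN] := treelike_unif th.
have [|w a] := hN (pre N x); first by rewrite size_pre.
have [s ss E] := pre_cat_ex N n x; have [s' ss' a'] := aff_cat s a; rewrite -E in a'.
apply: (bx (N + n)) => -[|k]; first by eexists.
have : stab h (pre (size (w ++ s')) (h x)).
  by apply: stab_pre st; rewrite size_cat ss' ss leq_addl.
rewrite (aff_pre a'); last by rewrite size_pre.
by move=> /(_ k)[u r]; exists u; exists (w ++ s').
Qed.

Lemma stab_or_near (R : seq bits) n : (forall x, unstable h x <-> x \in R) ->
  exists2 L, n <= L & forall v, L <= size v ->
    stab h v \/ exists2 a, a \in R & pre n a = take n v.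
Proof.
move=> hR; have [||L hL] := @konig (fun v => n <= size v /\
    (stab h v \/ exists2 a, a \in R & pre n a = take n v)).
- move=> v s [ln [st|[a aR E]]]; split; rewrite ?size_cat ?(leq_trans ln) ?leq_addr //.
    by left; exact: stab_cat.
  by right; exists a => //; rewrite takel_cat.
- move=> x; case: (pselect (unstable h x)) => [/hR xR|nb].
    exists n; rewrite size_pre; split => //; right; exists x => //.
    by rewrite pre_take.
  have [m st] : exists m, stab h (pre m x).
    by apply: contrapT => H; apply: nb => m st; apply: H; exists m.
  exists (maxn n m); rewrite size_pre leq_maxl; split=> //; left.
  by apply: stab_pre st; rewrite leq_maxr.
exists (maxn n L); first by rewrite leq_maxl.
by move=> v; rewrite geq_max => /andP[_ /hL[]].
Qed.

End Dynamics.

(** * Attracting and repelling points *)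

Section Attraction.
Variables h g : bits -> bits.
Hypotheses (hK : cancel h g) (gK : cancel g h).
Hypotheses (th : treelike h) (tg : treelike g).
Variables A R : seq bits.
Hypotheses (hA : forall x, unstable g x <-> x \in A) (hR : forall x, unstable h x <-> x \in R).

(* A long vertex [w] of the orbit of [v] cannot extend a [g]-stable vertex [u]
   of fixed length: pulled back to [v], [u] would get a negative length. *)
Lemma stab_attracted v n : stab h v -> ~ periodic h v ->
  exists K, forall k, K <= k -> forall w, reach h k v w ->
    forall y, pre (size w) y = w -> near n A y.
Proof.
move=> st np; have [L le hL] := stab_or_near n hA.
have [K hK'] := stab_deep (size v + L).+1 (can_inj hK) st np.
exists K => k lk w r y ey; have sw := hK' k lk w r.
have [|/(_ k)[u' ru]|[a aA E]] := hL (take L w).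
- by rewrite size_takel //; lia.
- exfalso; have [s' ss' r'] := reach_cat (drop L w) ru; move: r'; rewrite cat_take_drop.
  move=> /(reach_fun (reach_rev hK r)) /(congr1 size).
  by rewrite size_cat ss' size_drop; lia.
- exists a => //; rewrite E take_takel // -ey pre_take //; lia.
Qed.

(** Small cylinders at a repelling point are [g]-stable. A locally periodic point in one would force
    some power of [g], hence of [h], to return the whole cylinder to itself, making it
    [h]-stable. *)
Lemma loc_periodic_far : exists n0, forall x, loc_periodic h x -> ~ near n0 R x.
Proof.
have [|n0 hn0] := @unif_seq _ R (fun x n => stab g (pre n x)).
  move=> x /hR /(unstable_stab_inv hK th)[n st]; exists n => k lk; exact: stab_pre st.
exists n0 => y [m per] [x xR E]; have st := hn0 x xR n0 (leqnn _).
have [k k0 r] := periodic_pre (leq_maxr n0 m) per.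
have [s _ Es] := pre_cat_ex n0 (maxn n0 m - n0) y; rewrite subnKC ?leq_maxl // in Es.
rewrite Es -E in r; have [w' rw] := st k.
have [s' ss' r'] := reach_cat s rw.
have /eqP := reach_fun (reach_rev hK r) r'.
have := congr1 size (reach_fun (reach_rev hK r) r').
rewrite !size_cat ss' => /addIn szE; rewrite eqseq_cat // => /andP[/eqP ew _].
move: rw; rewrite -ew => /(reach_rev gK) rw; apply: ((hR x).2 xR n0).
by apply: (@loop_stab _ k _ [::]); rewrite ?cats0.
Qed.

(** Locally periodic points stay away from [R], so their prefixes of one fixed length [L] are stable
    and therefore periodic. The product of the doubled periods over all words of length [L] is a
    common multiple. *)
Lemma loc_periodic_order : exists2 P, 0 < P & forall x, loc_periodic h x -> iter P h x = x.
Proof.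
have [n0 hn0] := loc_periodic_far; have [L leL hL] := stab_or_near n0 hR.
have /choice[f hf] (v : seq bool) : exists k,
    0 < k /\ (periodic h v -> reach h k v v).
  case: (pselect (periodic h v)) => [[k k0 r]|np]; first by exists k.
  by exists 1; split.
exists (\prod_(v <- verts L) (f v + f v)).
  by apply: prodn_gt0 => v; have := (hf v).1; lia.
move=> x px; have [|st|[a aR E]] := hL (pre L x); first by rewrite size_pre.
  have per := loc_periodic_stab px st.
  have E := periodic_id ((hf _).2 per).
  rewrite (perm_big _ (perm_to_rem (verts_pre L x))) big_cons /= mulnC.
  by elim: (\prod_(_ <- _) _) => // m IH; rewrite mulSn addnC ssrnat.iterD E.
by exfalso; apply: (hn0 x px); exists a => //; rewrite E pre_take.
Qed.

Lemma loc_periodic_closed x : ~ loc_periodic h x -> exists n, forall y, pre n y = pre n x -> ~ loc_periodic h y.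
Proof.
move=> np; case: (pselect (unstable h x)) => [/hR xR|nb].
  have [n hn] := loc_periodic_far; exists n => y E /hn; apply; by exists x.
have [m st] : exists m, stab h (pre m x).
  by apply: contrapT => H; apply: nb => m st; apply: H; exists m.
by exists m => y E py; apply: np; exists m; rewrite -E; apply: loc_periodic_stab; rewrite ?E.
Qed.

Lemma north_south n : exists K, forall k, K <= k -> forall x,
  ~ loc_periodic h x -> ~ near n R x -> near n A (iter k h x).
Proof.
have [L leL hL] := stab_or_near n hR.
have [|K hK'] := @unif_seq _ (verts L) (fun v k => stab h v -> ~ periodic h v ->
   forall w, reach h k v w -> forall y, pre (size w) y = w -> near n A y).
  move=> v _; case: (pselect (stab h v /\ ~ periodic h v)) => [[st np]|H].
    by have [K hK'] := stab_attracted n st np; exists K => k lk _ _; exact: hK'.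
  by exists 0 => k _ st np; exfalso; apply: H.
exists K => k lk x npx nnx; have [|st|[a aR E]] := hL (pre L x).
- by rewrite size_pre.
- have np : ~ periodic h (pre L x) by move=> p; apply: npx; exists L.
  have [w r] := st k; apply: (hK' _ (verts_pre L x) k lk st np w r).
  by apply: (aff_pre (reach_aff r)); rewrite size_pre.
- by exfalso; apply: nnx; exists a => //; rewrite E pre_take.
Qed.

End Attraction.

Theorem dynamics h g : cancel h g -> cancel g h -> treelike h -> treelike g ->
  exists A R : seq bits,
  [/\ (exists2 P, 0 < P & forall x, loc_periodic h x -> iter P h x = x),
      forall x, ~ loc_periodic h x -> exists n, forall y, pre n y = pre n x -> ~ loc_periodic h y,
      forall x, x \in R -> h x \in R &
      forall n, exists K, forall k, K <= k -> forall x,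
        ~ loc_periodic h x -> ~ near n R x -> near n A (iter k h x)].
Proof.
move=> hK gK th tg.
(* The attracting points of [h] are the unstable points of its inverse. *)
have [A hA] := unstable_finite gK tg; have [R hR] := unstable_finite hK th.
exists A, R; split.
- exact: (loc_periodic_order hK gK th hR).
- by move=> x; exact: (loc_periodic_closed hK gK th hR).
- by move=> x /hR /(unstable_step th) /hR.
- exact: (north_south hK hA hR).
Qed.

(** * Ping-pong *)

Definition map_group (G : set (bits -> bits)) : Prop :=
  [/\ G id, forall h k, G h -> G k -> G (k \o h),
      forall h, G h -> exists g, [/\ G g, cancel h g & cancel g h] &
      forall h, G h -> treelike h].

Definition letter (a a' b b' : bits -> bits) (l : bool * bool) : bits -> bits :=
  if l.1 then (if l.2 then a' else a) else (if l.2 then b' else b).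

Definition evalw a a' b b' (w : seq (bool * bool)) : bits -> bits :=
  foldr (fun l f => letter a a' b b' l \o f) id w.

Definition acts_freely (G : set (bits -> bits)) : Prop :=
  exists a a' b b', [/\ [/\ G a, G a', G b & G b'],
    [/\ cancel a a', cancel a' a, cancel b b' & cancel b' b] &
    forall w, reduced_word w -> w <> [::] -> exists z, evalw a a' b b' w z <> z].

Lemma near_le m n F x : m <= n -> near n F x -> near m F x.
Proof. by move=> le [a aF E]; exists a => //; exact: pre_le E. Qed.

Lemma near_sub n (F F' : seq bits) x : {subset F <= F'} -> near n F x -> near n F' x.
Proof. by move=> sub [a aF E]; exists a => //; exact: sub. Qed.

Lemma near_in n (F : seq bits) x : x \in F -> near n F x.
Proof. by move=> xF; exists x. Qed.

Lemma bits_neq (x y : bits) : x <> y -> exists n, forall k, n <= k -> pre k x <> pre k y.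
Proof.
move=> ne; apply: contrapT => H; apply: ne; apply: bits_eq => n.
by apply: contrapT => ne; apply: H; exists n => k lk /(pre_le lk).
Qed.

Lemma not_near (F : seq bits) x : x \notin F -> exists n, forall k, n <= k -> ~ near k F x.
Proof.
move=> xF; have [|n hn] := @unif_seq _ F (fun a k => pre k a <> pre k x).
  by move=> a aF; apply: bits_neq => E; rewrite -E aF in xF.
by exists n => k lk [a aF E]; exact: (hn a aF k lk).
Qed.

Lemma near_disjoint (F F' : seq bits) : (forall a, a \in F -> a \notin F') ->
  exists n, forall k, n <= k -> forall y, near k F y -> near k F' y -> False.
Proof.
move=> H; have [|n hn] := @unif_seq _ F (fun a k => ~ near k F' a).
  by move=> a /H; exact: not_near.
exists n => k lk y [a aF E] [b bF E']; apply: (hn a aF k lk).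
by exists b => //; rewrite E' E.
Qed.

Lemma fresh_bits (F : seq bits) : exists z, z \notin F.
Proof.
have fi : injective (fun k i : nat => i == k).
  by move=> k l /(congr1 (fun z : bits => z k)); rewrite eqxx => /esym/eqP.
by have [K hK] := inj_avoid F fi; exists (fun i => i == K); exact: hK.
Qed.

Lemma iter_fixed (T : Type) (h : T -> T) P m x : iter P h x = x -> iter (m * P) h x = x.
Proof. by move=> E; elim: m => // m IH; rewrite mulSn ssrnat.iterD IH. Qed.

Section Group.
Variable G : set (bits -> bits).
Hypothesis hG : map_group G.

Lemma group_iter h k : G h -> G (iter k h).
Proof.
case: hG => id1 cp _ _ Gh; elim: k => // k IH.
exact: (cp _ _ IH Gh).
Qed.

(* Induction on [F]: if [g a] falls into [F'] although [g] moves the rest of [F]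
   off [F''], correct [g] by the chosen element sending [g a] to [t0 a]; [F'']
   is [F'] enlarged so that this correction does no harm to the rest of [F]. *)
Lemma neumann : (forall x (F : seq bits), exists2 t, G t & t x \notin F) ->
  forall F F' : seq bits, exists2 t, G t & forall a, a \in F -> t a \notin F'.
Proof.
case: hG => id1 cp inv _ inf; elim=> [|a F IH] F'; first by exists id.
have [t0 Gt0 ht0] := inf a F'.
have /choice[mn hmn] c : exists mn : (bits -> bits) * (bits -> bits),
    (exists2 m, G m & m c = t0 a) ->
    [/\ G mn.1, cancel mn.1 mn.2 & mn.1 c = t0 a].
  case: (pselect (exists2 m, G m & m c = t0 a)) => [[m Gm E]|ne].
    by have [n [_ mK _]] := inv m Gm; exists (m, n).
  by exists (id, id).
have [g Gg hg] := IH (F' ++ [seq (mn c).2 b | c <- F', b <- F']).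
have [gaF|gaF] := boolP (g a \in F'); last first.
  exists g => // b; rewrite in_cons => /orP[/eqP -> //|/hg].
  by rewrite mem_cat negb_or => /andP[].
have [|Gm mK E] := hmn (g a).
  have [g' [Gg' gK _]] := inv g Gg.
  by exists (t0 \o g'); [exact: cp|rewrite /= gK].
exists ((mn (g a)).1 \o g); first exact: cp.
move=> b; rewrite in_cons => /orP[/eqP ->|/hg]; first by rewrite /= E.
rewrite mem_cat negb_or => /andP[_]; apply: contraNN => /= H.
by apply/allpairsP; exists (g a, (mn (g a)).1 (g b)); split=> //=.
Qed.

(* If [f] works for [l], then [iter k h \o f] works for [h :: l] when [k] is large
   and [f] is chosen, after [k], with a sufficiently strong contraction. *)
Lemma contraction (l : seq (bits -> bits)) : (forall h, h \in l -> G h) ->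
  exists A R : seq bits, forall n, exists2 f, G f &
    (forall x, (forall h, h \in l -> loc_periodic h x) -> f x = x) /\
    (forall x, (exists2 h, h \in l & ~ loc_periodic h x) -> ~ near n R x -> near n A (f x)).
Proof.
case: (hG) => id1 cp inv tl; elim: l => [|h l IH] Gl.
  by exists [::], [::] => n; exists id => //; split=> // x [].
have [|A1 [R1 H1]] := IH; first by move=> k kl; apply: Gl; rewrite in_cons kl orbT.
have Gh : G h by apply: Gl; rewrite mem_head.
have [g [Gg hK gK]] := inv h Gh.
have [A2 [R2 [[P P0 hP] _ hR2 ns]]] := dynamics hK gK (tl _ Gh) (tl _ Gg).
(* The iterate of [h] sends a point of [A1] near [A2], unless it fixes that point or the point lies
   in [R2], which [h] maps into itself; hence the three summands. *)
exists (A1 ++ A2 ++ R2), (R1 ++ R2) => n.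
have [|n2 hn2] := @unif_seq _ [seq a <- A1 | a \notin R2] (fun a k => ~ near k R2 a).
  by move=> a; rewrite mem_filter => /andP[/not_near].
pose n' := maxn n n2; have [K hK'] := ns n'.
have iR k a : a \in R2 -> iter k h a \in R2 by move=> ha; elim: k => //= k; exact: hR2.
have lk : K <= K * P by nia.
set k := K * P in lk.
have kP x : loc_periodic h x -> iter k h x = x by move=> /hP; exact: iter_fixed.
have [n1 hn1] := treelike_continuous n (tl _ (group_iter k Gh)).
have [f Gf [f1 f2]] := H1 (maxn n1 n).
exists (iter k h \o f); first by apply: cp => //; exact: group_iter.
have sA1 : {subset A1 <= A1 ++ A2 ++ R2} by move=> a; rewrite mem_cat => ->.
have sA2 : {subset A2 <= A1 ++ A2 ++ R2} by move=> a; rewrite !mem_cat => ->; rewrite orbT.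
have sR2 : {subset R2 <= A1 ++ A2 ++ R2} by move=> a; rewrite !mem_cat => ->; rewrite !orbT.
split=> [x H|x H nR] /=.
  rewrite f1 ?kP //; first by apply: H; rewrite mem_head.
  by move=> h' h'l; apply: H; rewrite in_cons h'l orbT.
case: (pselect (exists2 h', h' \in l & ~ loc_periodic h' x)) => [H'|H'].
  have [|a aA Ea] := f2 x H'.
    move=> /(near_le (leq_maxr _ _)) /(@near_sub _ _ (R1 ++ R2)) nr; apply: nR.
    by apply: nr => b; rewrite mem_cat => ->.
  suff [b bA Eb] : near n (A1 ++ A2 ++ R2) (iter k h a).
    exists b => //; rewrite Eb; apply: hn1; exact: pre_le (leq_maxl _ _) Ea.
  case: (pselect (loc_periodic h a)) => [/kP ->|npa]; first exact/near_in/sA1.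
  have [aR|aR] := boolP (a \in R2); first exact/near_in/sR2/iR.
  apply: (near_sub sA2); apply: near_le (leq_maxl n n2) _; apply: hK' => //.
  by apply: hn2; rewrite ?mem_filter ?aR ?leq_maxr.
have ex : forall h', h' \in l -> loc_periodic h' x.
  by move=> h' h'l; apply: contrapT => np; apply: H'; exists h'.
rewrite f1 //; apply: (near_sub sA2); apply: near_le (leq_maxl n n2) _; apply: hK' => //.
  case: H => h'; rewrite in_cons => /orP[/eqP -> //|/ex]; by [].
move=> /(near_le (leq_maxl _ _)) /(@near_sub _ _ (R1 ++ R2)) nr; apply: nR.
by apply: nr => b; rewrite mem_cat orbC => ->.
Qed.

(** By compactness finitely many [h] suffice for every point to be outside the locally periodic set
    of one of them, so [contraction] fixes no points by necessity. *)
Lemma global_contraction : (forall x, exists2 h, G h & ~ loc_periodic h x) ->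
  exists A R : seq bits, forall n, exists2 f, G f &
    forall x, ~ near n R x -> near n A (f x).
Proof.
case: (hG) => id1 cp inv tl H.
have [||L hL] := @konig (fun v => exists2 h, G h & forall x, pre (size v) x = v -> ~ loc_periodic h x).
- move=> v s [h Gh hv]; exists h => // x E; apply: hv.
  by rewrite -(@pre_take _ (size (v ++ s))) ?E ?take_size_cat // size_cat leq_addr.
- move=> x; have [h Gh np] := H x; have [g [Gg hK gK]] := inv h Gh.
  have [_ [_ [_ cl _ _]]] := dynamics hK gK (tl _ Gh) (tl _ Gg).
  by have [n hn] := cl x np; exists n, h => // y; rewrite size_pre => /hn.
have /choice[c hc] v : exists h, L <= size v -> G h /\
    forall x, pre (size v) x = v -> ~ loc_periodic h x.
  case: (leqP L (size v)) => [/hL[h Gh hv]|]; first by exists h.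
  by exists id.
have [|A [R HAR]] := @contraction [seq c v | v <- verts L].
  by move=> h /mapP[v /mem_vertsP sv ->]; apply: (hc v _).1; rewrite sv.
exists A, R => n; have [f Gf [_ hf]] := HAR n; exists f => // x; apply: hf.
exists (c (pre L x)); first by apply: map_f; exact: verts_pre.
by apply: (hc _ _).2; rewrite size_pre.
Qed.

(** A strong contraction followed by [u], which moves the attractor off [R], gives [a] with disjoint
    attracting set [A1] and repelling set [R]. Conjugating by [v], which moves [Z] off itself, gives
    a second map whose sets avoid those of [a]. *)
Lemma ping_pong : (forall x (F : seq bits), exists2 t, G t & t x \notin F) ->
  (forall x, exists2 h, G h & ~ loc_periodic h x) -> acts_freely G.
Proof.
case: (hG) => id1 cp inv tl inf exnp.
have nm := neumann inf.
have [A [R HAR]] := global_contraction exnp.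
have [u Gu hu] := nm A R.
set A1 := map u A; set Z := A1 ++ R.
have [v Gv hv] := nm Z Z.
have [v' [Gv' vK v'K]] := inv v Gv.
have [z] := fresh_bits (Z ++ map v Z); rewrite mem_cat negb_or => /andP[z1 z2].
have z3 : v' z \notin Z.
  by apply: contra z2 => H; apply/mapP; exists (v' z).
have [|m1 hm1] := @near_disjoint A1 R.
  by move=> _ /mapP[a aA ->]; exact: hu.
have [|m2 hm2] := @near_disjoint (map v Z) Z.
  by move=> _ /mapP[a aA ->]; exact: hv.
have [m3 hm3] := treelike_continuous m2 (tl _ Gv).
have [m4 hm4] := not_near z1; have [m5 hm5] := not_near z3.
(* At scale [m] the four sets and the base point [z] are separated; [m6] is the precision at which
   [f] must contract for [u \o f] to contract at scale [m]. *)
pose m := m1 + m2 + m3 + m4 + m5.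
have [m6 hm6] := treelike_continuous m (tl _ Gu).
have [f Gf hf] := HAR (m6 + m).
have [a' [Ga' aK a'K]] := inv (u \o f) (cp _ _ Gf Gu).
set a := u \o f in aK a'K.
have Ga : G a by exact: cp.
have dyn y : ~ near m R y -> near m A1 (a y).
  move=> nR; have [|c cA E] := hf y; first by move=> /(near_le (leq_addl _ _)).
  exists (u c); first exact: map_f.
  by apply: hm6; exact: pre_le (leq_addr _ _) E.
have dyn' y : ~ near m A1 y -> near m R (a' y).
  by move=> nA; apply: contrapT => /dyn; rewrite a'K.
exists a, a', (v \o a \o v'), (v \o a' \o v'); split.
- by split=> //; exact: (cp _ _ Gv' (cp _ _ _ Gv)).
- by split=> // y /=; rewrite vK ?aK ?a'K v'K.
(* [T l] is the region into which the letter [l] sends everything outside the region of its inverse;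
   for the conjugated generator it is read through [v']. *)
pose T (l : bool * bool) y := near m (if l.2 then R else A1) (if l.1 then y else v' y).
have TZ l y : T l y -> near m Z (if l.1 then y else v' y).
  by apply: near_sub => c cl; rewrite mem_cat; case: (l.2) cl => ->; rewrite ?orbT.
have lm1 : m1 <= m by rewrite /m; lia.
have lm4 : m4 <= m by rewrite /m; lia.
have lm5 : m5 <= m by rewrite /m; lia.
have T1 l l' y : l.1 = l'.1 -> T l y -> T l' y -> l = l'.
  move: l l' => [i j] [i' j'] /= -> ; rewrite /T /=; case: j; case: j' => // t t';
    by exfalso; (exact: (hm1 m lm1 _ t' t) || exact: (hm1 m lm1 _ t t')).
have T2 (l l' : bool * bool) y : l.1 -> ~~ l'.1 -> T l y -> T l' y -> False.
  move=> e e' /TZ + /TZ; rewrite e (negbTE e') => t [c cZ E].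
  apply: (hm2 m2 (leqnn _) y); last by apply: near_le t; rewrite /m; lia.
  exists (v c); first exact: map_f.
  by rewrite -(v'K y); apply: hm3; apply: pre_le E; rewrite /m; lia.
have T3 l l' y : T l y -> T l' y -> l = l'.
  move=> t t'; case e: (l.1) ; case e': (l'.1).
  - by apply: T1 t t'; rewrite e e'.
  - by exfalso; apply: (T2 l l' y); rewrite ?e ?e'.
  - by exfalso; apply: (T2 l' l y); rewrite ?e ?e'.
  - by apply: T1 t t'; rewrite e e'.
have T0 l : ~ T l z.
  by move=> /TZ; case: (l.1); [exact: hm4|exact: hm5].
have TL l y : ~ T (l.1, ~~ l.2) y -> T l (letter a a' (v \o a \o v') (v \o a' \o v') l y).
  by move: l => [[] []]; rewrite /T /= ?vK; [exact: dyn'|exact: dyn|exact: dyn'|exact: dyn].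
suff Tw l w : reduced_word (l :: w) ->
    T l (evalw a a' (v \o a \o v') (v \o a' \o v') (l :: w) z).
  by move=> [//|l w] rw _; exists z => E; apply: (T0 l); rewrite -E; exact: Tw.
elim: w l => [|k w IH] l rw /=; apply: TL; first exact: T0.
move: rw => /= /andP[lk kw] t; have E := T3 _ _ _ t (IH k kw).
by move: lk; rewrite -E /= eqxx /=; case: (l.2).
Qed.

End Group.

(** * Finite orbits *)

(** Only a monoid; it is a group once [S] contains the inverses of its elements. *)
Inductive gen (S : seq (bits -> bits)) : (bits -> bits) -> Prop :=
| gen_id : gen S id
| gen_step s h : s \in S -> gen S h -> gen S (s \o h).

Lemma gen_sub (S : seq (bits -> bits)) s : s \in S -> gen S s.
Proof. by move=> sS; exact: (gen_step sS (gen_id S)). Qed.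

Lemma gen_comp S h k : gen S h -> gen S k -> gen S (k \o h).
Proof.
move=> gh; elim=> [|s k' sS _ IH]; first exact: gh.
exact: (gen_step sS IH).
Qed.

Lemma gen_mono (S S' : seq (bits -> bits)) h : {subset S <= S'} -> gen S h -> gen S' h.
Proof.
move=> sub; elim=> [|s k sS _ IH]; first exact: gen_id.
exact: gen_step (sub _ sS) IH.
Qed.

(** Unlike [loc_periodic], this does not mention the cylinders met on the way, so it passes through
    conjugations. *)
Definition loc_torsion (h : bits -> bits) x :=
  exists2 k, 0 < k & exists n, forall y, pre n y = pre n x -> iter k h y = y.

Lemma loc_periodic_loc_torsion h x : loc_periodic h x -> loc_torsion h x.
Proof.
move=> [n [k k0 r]]; exists (k + k); first lia.
by exists n => y E; apply: (@periodic_id _ _ n); rewrite E.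
Qed.

Lemma loc_torsion_conj p q h x : cancel p q -> cancel q p -> treelike q ->
  loc_torsion (q \o h \o p) x -> loc_torsion h (p x).
Proof.
move=> pK qK tq [k k0 [n hn]]; have [m hm] := treelike_continuous n tq.
exists k => //; exists m => y /hm; rewrite pK => /hn.
have E z : iter k (q \o h \o p) z = q (iter k h (p z)).
  by elim: k {k0 hn} => [|k IH] /=; rewrite ?pK // IH qK.
by rewrite E qK => /(can_inj qK).
Qed.

(** The [k]-th iterate lengthens [u] by [k * size z] letters, but it is the identity on small
    cylinders around [x], which forbids any change of length. *)
Lemma loc_torsion_noloop h u z x : loc_torsion h x -> pre (size u) x = u ->
  aff h u (u ++ z) -> z = [::].
Proof.
move=> [k k0 [n hn]] Eu a; apply/nilP/eqP.
have [z' sz a'] : exists2 z', size z' = k * size z & aff (iter k h) u (u ++ z').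
  elim: k {k0 hn} => [|k [z' sz IH]].
    by exists [::]; rewrite ?cats0 //; exact: aff_id.
  have [s ss a'] := aff_cat z' a.
  exists (z ++ s); first by rewrite size_cat ss sz mulSn.
  by rewrite catA; exact: aff_comp IH a'.
have [s _ E] := pre_cat_ex (size u) n x; rewrite Eu in E.
have [s' ss a''] := aff_cat s a'; rewrite -E in a''.
have ai : aff (iter k h) (pre (size u + n) x) (pre (size u + n) x).
  exists false => y; rewrite xb0 hn //.
  by rewrite pre_catbW ?size_pre ?leq_addl // pre_take ?leq_addl.
have := aff_size a'' ai; rewrite E !size_cat ss sz; nia.
Qed.

Fixpoint word (s : nat -> bits -> bits) (i d : nat) : bits -> bits :=
  if d is d'.+1 then s (i + d') \o word s i d' else id.

Section FiniteOrbit.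
Variable S : seq (bits -> bits).
Hypothesis tS : forall s, s \in S -> treelike s.
Hypothesis invS : forall s, s \in S -> exists s', [/\ s' \in S, cancel s s' & cancel s' s].

Lemma gen_treelike h : gen S h -> treelike h.
Proof.
elim=> [|s k sS _ IH]; first exact: treelike_id.
exact: treelike_comp IH (tS sS).
Qed.

Lemma gen_inv h : gen S h -> exists g, [/\ gen S g, cancel h g & cancel g h].
Proof.
elim=> [|s k sS _ [k' [gk' kK k'K]]].
  by exists id; split=> //; exact: gen_id.
have [s' [s'S sK s'K]] := invS sS; exists (k' \o s'); split.
- by apply: gen_comp gk'; exact: gen_sub.
- by move=> y /=; rewrite sK kK.
- by move=> y /=; rewrite k'K s'K.
Qed.

Lemma gen_word s i d : (forall j, j < i + d -> s j \in S) -> gen S (word s i d).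
Proof.
elim: d => [|d IH] H /=; first exact: gen_id.
apply: gen_step; first by apply: H; rewrite addnS.
by apply: IH => j lj; apply: H; rewrite addnS ltnW.
Qed.

Lemma word_ext s t i d : (forall j, j < i + d -> s j = t j) -> word s i d = word t i d.
Proof.
elim: d => [|d IH] H //=; rewrite H ?addnS // IH // => j lj.
by apply: H; rewrite addnS ltnW.
Qed.

Lemma word_gen h : gen S h -> exists s d, (forall j, j < d -> s j \in S) /\ h = word s 0 d.
Proof.
elim=> [|t k tS' _ [s [d [hs ->]]]]; first by exists (fun=> id), 0.
pose s' i := if i < d then s i else t.
exists s', d.+1; split=> [j|/=]; rewrite /s'.
  by case: (ltnP j d) => // /hs.
rewrite add0n ltnn (_ : word s 0 d = word s' 0 d) //.
by apply: word_ext => j; rewrite add0n /s' => ->.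
Qed.

Variable N : nat.
Hypothesis hN : forall s, s \in S -> forall v, N <= size v -> exists w, aff s v w.

(** The generator is already affine on the ancestor obtained by dropping [r] letters, and the
    dropped letters reappear, possibly complemented, at the end of the image. *)
Lemma aff_trunc s v w r : s \in S -> N + r <= size v -> aff s v w ->
  r <= size w /\ aff s (take (size v - r) v) (take (size w - r) w).
Proof.
move=> sS le a; have [|u au] := hN sS (v := take (size v - r) v).
  by rewrite size_takel; lia.
have [s' ss] := aff_cat (drop (size v - r) v) au; rewrite cat_take_drop => a'.
have sr : size s' = r by rewrite ss size_drop; lia.
rewrite (aff_fun a a') size_cat sr addnK take_size_cat //; split=> //.
exact: leq_addl.
Qed.

Variable J : nat.
Hypothesis hJ : forall s, s \in S -> forall v w, N <= size v -> aff s v w -> size w <= size v + J.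

Variable x0 : bits.
Hypothesis hx0 : forall h, gen S h -> loc_torsion h x0.

Lemma orbit_loc_torsion p h : gen S p -> gen S h -> loc_torsion h (p x0).
Proof.
move=> gp gh; have [q [gq pK qK]] := gen_inv gp.
apply: (loc_torsion_conj pK qK (gen_treelike gq)); apply: hx0.
exact: gen_comp gp (gen_comp gh gq).
Qed.

Definition path_of (s : nat -> bits -> bits) (v : nat -> seq bool) (k : nat) : Prop :=
  (forall i, i < k -> s i \in S /\ aff (s i) (v i) (v i.+1)) /\
  (forall i, i <= k -> N <= size (v i)).

(** The number of words of length [N] times the largest rise in one step, as the pigeonhole
    principle requires. *)
Definition drift := (2 ^ N) * J.

Lemma path_trunc s v k i d r : path_of s v k -> i + d <= k ->
  (forall j, i <= j <= i + d -> N + r <= size (v j)) ->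
  aff (word s i d) (take (size (v i) - r) (v i)) (take (size (v (i + d)) - r) (v (i + d))).
Proof.
move=> pth; elim: d => [|d IH] le H; first by rewrite addn0; exact: aff_id.
have [|sS a] := pth.1 (i + d); first lia.
apply: (aff_comp (IH _ _)); first lia.
  by move=> j /andP[l1 l2]; apply: H; lia.
rewrite addnS; apply: (aff_trunc sS _ a).2; apply: H; lia.
Qed.

(* Let [tau r] be the last time the level is at most [a0 + r J]. After it the
   levels stay higher, so the length-[N] ancestors at these times are mapped
   along the path; two of them agree if the drift is large, giving a loop. *)
Lemma path_drift p s v k : gen S p -> path_of s v k ->
  pre (size (v 0)) (p x0) = v 0 -> size (v k) <= size (v 0) + drift.
Proof.
move=> gp pth E0; rewrite leqNgt; apply/negP => big.
have sN := pth.2; pose a i := size (v i).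
have ex r : exists i, (i <= k) && (a i <= a 0 + r * J) by exists 0; rewrite leq_addr.
have ub r i : (i <= k) && (a i <= a 0 + r * J) -> i <= k by case/andP.
pose tau r := ex_maxn (ex r) (@ub r).
have [t1 t2] : (forall r, (tau r <= k) && (a (tau r) <= a 0 + r * J)) /\
    (forall r i, i <= k -> a i <= a 0 + r * J -> i <= tau r).
  split=> r; rewrite /tau; case: ex_maxnP => // m _ H i l1 l2; apply: H.
  by rewrite l1.
(* The level just after [tau r] exceeds [a 0 + r * J] and one step rises by at most [J]. So
   [a (tau r)] lies in a window of width [J] below that value, and distinct [r] give distinct
   levels. *)
have t3 (r : 'I_(2 ^ N).+1) : a 0 + r * J < a (tau r) + J.
  have /andP[tk ta] := t1 r.
  have lt : tau r < k.
    rewrite ltn_neqAle tk andbT; apply/eqP => e; move: ta; rewrite e /a.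
    have : r * J <= drift by rewrite leq_mul2r -ltnS ltn_ord orbT.
    lia.
  have [sS af] := pth.1 _ lt.
  have := hJ sS (sN _ tk) af; rewrite -/(a _) -/(a _) => le.
  apply: leq_trans le; rewrite ltnNge; apply/negP => /(t2 r _ lt); lia.
pose f (r : 'I_(2 ^ N).+1) : N.-tuple bool := [tuple of pre N (word s 0 (tau r) (p x0))].
have [r [r' [lt ff]]] : exists r r' : 'I_(2 ^ N).+1, r < r' /\ f r = f r'.
  apply: contrapT => H.
  have fi : injective f.
    move=> r r' e; apply: val_inj; case: (ltngtP r r') => // c; exfalso; apply: H.
      by exists r, r'.
    by exists r', r.
  by have := leq_card f fi; rewrite card_ord card_tuple card_bool ltnn.
have {}ff : pre N (word s 0 (tau r) (p x0)) = pre N (word s 0 (tau r') (p x0)).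
  exact: (congr1 val ff).
have /andP[ik ai] := t1 r; have /andP[ik' ai'] := t1 r'.
have a' := t3 r'.
have aa : a (tau r) < a (tau r') by nia.
have ii : tau r < tau r'.
  rewrite ltnNge leq_eqVlt; apply/negP => /orP[/eqP e|l]; first by rewrite e ltnn in aa.
  have := @t2 r' (tau r) ik; nia.
have later j : tau r <= j <= k -> a (tau r) <= a j.
  move=> /andP[]; rewrite leq_eqVlt => /orP[/eqP <- //|l jk].
  by rewrite leqNgt; apply/negP => l'; have := t2 r j jk; lia.
have inw d : d <= k -> pre (a d) (word s 0 d (p x0)) = v d.
  move=> dk; have := @path_trunc s v k 0 d 0 pth dk; rewrite !subn0 !take_size add0n.
  move=> A; have := aff_pre (A _) E0; apply=> j /andP[_ jd].
  by rewrite addn0; apply: sN; lia.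
(* Dropping [c] letters leaves exactly [N] at time [tau r]. From then on levels are at least
   [a (tau r)], so the whole stretch of the path can be truncated by [c]. *)
pose c := a (tau r) - N.
have cN : c + N = a (tau r) by rewrite subnK //; exact: sN.
have := @path_trunc s v k (tau r) (tau r' - tau r) c pth; rewrite subnKC ?(ltnW ii) //.
move=> /(_ ik') A; have {}A := A _.
set u := take (size (v (tau r)) - c) (v (tau r)) in A.
have Eu : u = pre N (word s 0 (tau r) (p x0)).
  rewrite /u -(inw _ ik) size_pre pre_take ?leq_subr //; congr pre; lia.
set w := take _ (v (tau r')) in A.
have Ew : w = pre (a (tau r') - c) (word s 0 (tau r') (p x0)).
  by rewrite /w -[X in take _ X](inw _ ik') pre_take //; exact: leq_subr.
have [z sz Ez] := pre_cat_ex N (a (tau r') - c - N) (word s 0 (tau r') (p x0)).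
rewrite subnKC in Ez; last lia.
rewrite Ew Ez -ff -Eu in A.
suff z0 : z = [::] by move: sz; rewrite z0 /=; lia.
have sS j : j < k -> s j \in S by move=> /(pth.1 j)[].
apply: (@loc_torsion_noloop (word s (tau r) (tau r' - tau r)) u z
         (word s 0 (tau r) (p x0))).
- apply: (@orbit_loc_torsion (word s 0 (tau r) \o p)).
    by apply: gen_comp gp _; apply: gen_word => j lj; apply: sS; lia.
  by apply: gen_word => j lj; apply: sS; lia.
- by rewrite Eu size_pre.
- apply: A => j /andP[l1 l2]; have := later j; rewrite -cN /a; lia.
Qed.

(** The lower bound is [path_drift] for the path run backwards with inverse generators, from the
    orbit point where it ends. *)
Lemma path_bounds s v k : path_of s v k -> pre (size (v 0)) x0 = v 0 ->
  size (v k) <= size (v 0) + drift /\ size (v 0) <= size (v k) + drift.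
Proof.
move=> pth E0; split; first exact: (@path_drift id s v k (gen_id _) pth E0).
have /choice[iv hiv] (t : bits -> bits) : exists t', t \in S ->
    [/\ t' \in S, cancel t t' & cancel t' t].
  case: (boolP (t \in S)) => [/invS[t' H]|_]; first by exists t'.
  by exists id.
have inw : pre (size (v k)) (word s 0 k x0) = v k.
  have := @path_trunc s v k 0 k 0 pth (leqnn _); rewrite !subn0 !take_size add0n.
  move=> A; have := aff_pre (A _) E0; apply=> j /andP[_ jd].
  by rewrite addn0; apply: pth.2.
have := @path_drift (word s 0 k) (fun i => iv (s (k - i.+1))) (fun i => v (k - i)) k.
rewrite subn0 subnn; apply=> //.
  by apply: gen_word => j lj; case: (pth.1 j).
split=> i ik; last by apply: pth.2; rewrite leq_subr.
have [|sS af] := pth.1 (k - i.+1); first lia.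
have [s'S sK _] := hiv _ sS; split=> //; apply: (aff_inv sK).
by move: af; rewrite -subSn // subSS.
Qed.

(** Levels along any word stay within [drift] of the start, so every image of [x0] is a prefix of
    bounded length followed by one fixed tail or its complement. *)
Lemma finite_orbit : exists F : seq bits, forall h, gen S h -> h x0 \in F.
Proof.
(* [drift] allows for the descent of levels; with [N + N] letters left, the next generator is affine
   with an image of length at least [N]. *)
pose n0 := N + N + drift.
exists [seq catb w (xb e (shift n0 x0)) | w <- verts_lt (n0 + drift).+1, e <- [:: false; true]].
move=> h /word_gen[s [d [hs ->]]].
suff [v [pth E0]] : exists v, path_of s v d /\ v 0 = pre n0 x0.
  have sz0 : size (v 0) = n0 by rewrite E0 size_pre.
  have := @path_trunc s v d 0 d 0 pth (leqnn _).
  rewrite !subn0 !take_size add0n => -[|e he].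
    by move=> j /andP[_ jd]; rewrite addn0; apply: pth.2.
  have [|le _] := path_bounds pth; first by rewrite E0 size_pre.
  apply/allpairsP; exists (v d, e); split=> /=.
  - by apply: mem_verts_lt; rewrite ltnS -sz0.
  - by case: (e).
  - by rewrite -he E0 catb_pre.
elim: d hs => [|d IH] hs.
  by exists (fun=> pre n0 x0); split=> //; split=> // i _; rewrite size_pre /n0; lia.
have [|v [pth E0]] := IH; first by move=> j jd; apply: hs; rewrite ltnW.
have E0' : pre (size (v 0)) x0 = v 0 by rewrite E0 size_pre.
have [_ le] := path_bounds pth E0'.
have sz : N + N <= size (v d) by move: le; rewrite E0 size_pre /n0; lia.
have [|w aw] := hN (hs d (ltnSn _)) (v := v d); first lia.
have [wN _] := aff_trunc (hs d (ltnSn _)) sz aw.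
exists (fun i => if i <= d then v i else w); split=> //; split=> i.
  rewrite ltnS => le'; rewrite le'; split; first exact: hs.
  case: ltnP => c; first by case: (pth.1 i c).
  by have -> : i = d by lia.
by case: (leqP i d) => // c _; exact: pth.2.
Qed.

End FiniteOrbit.

Theorem free_or_finite_orbit (G : set (bits -> bits)) : map_group G ->
  acts_freely G \/ forall S : seq (bits -> bits), (forall s, s \in S -> G s) ->
    exists x (F : seq bits), forall h, gen S h -> h x \in F.
Proof.
move=> [id1 cp inv tl].
case: (pselect (acts_freely G)) => [fr|nfr]; [by left|right] => S0 GS0.
have /choice[iv hiv] (t : bits -> bits) : exists t', G t ->
    [/\ G t', cancel t t' & cancel t' t].
  case: (pselect (G t)) => [/inv[t' H]|]; first by exists t'.
  by exists id.
(* Inverses make [gen S] a group; an orbit that is infinite under [gen S0] is infinite under [gen S]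
   too. *)
pose S := S0 ++ map iv S0.
have GS s : s \in S -> G s.
  by rewrite mem_cat => /orP[/GS0//|/mapP[t /GS0 /hiv[Gt _ _] ->]].
have invS s : s \in S -> exists s', [/\ s' \in S, cancel s s' & cancel s' s].
  rewrite mem_cat => /orP[sS|/mapP[t tS ->]].
    have [_ sK s'K] := hiv s (GS0 _ sS); exists (iv s); split=> //.
    by rewrite mem_cat map_f ?orbT.
  have [_ sK s'K] := hiv t (GS0 _ tS); exists t; split=> //.
  by rewrite mem_cat tS.
have tS s : s \in S -> treelike s by move=> /GS/tl.
have Ggen h : gen S h -> G h.
  by elim=> // s k /GS Gs _ Gk; exact: cp.
apply: contrapT => nf.
have inf x (F : seq bits) : exists2 t, gen S t & t x \notin F.
  apply: contrapT => H; apply: nf; exists x, F => h gh; apply/negPn/negP => nF.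
  apply: H; exists h => //; apply: gen_mono gh => s sS0.
  by rewrite mem_cat sS0.
have [N hN] : exists N, forall s, s \in S -> forall v, N <= size v -> exists w, aff s v w.
  have [s sS|N hN] := @unif_seq _ S (fun s N => forall v, N <= size v -> exists w, aff s v w).
    have [N hN] := treelike_unif (tS s sS); exists N => k Nk v kv; apply: hN.
    exact: leq_trans kv.
  by exists N => s sS; exact: (hN s sS N).
(* How much a generator lengthens a deep word depends only on its first [N] letters, so finitely
   many words give the bound. *)
have [J hJ] : exists J, forall s, s \in S -> forall v w, N <= size v ->
    aff s v w -> size w <= size v + J.
  have [s sS|J hJ] := @unif_seq _ S (fun s J => forall v, v \in verts N ->
      forall w, aff s v w -> size w <= J).
    have [v _|J hJ] := @unif_seq _ (verts N) (fun v J => forall w, aff s v w -> size w <= J).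
      case: (pselect (exists w, aff s v w)) => [[w a]|n].
        by exists (size w) => k le w' a'; rewrite (aff_size a' a).
      by exists 0 => k _ w a; exfalso; apply: n; exists w.
    by exists J => k Jk v vN; exact: hJ.
  exists J => s sS v w le a; have [|u au] := hN s sS (take N v).
    by rewrite size_takel.
  have [s' ss] := aff_cat (drop N v) au; rewrite cat_take_drop => a'.
  rewrite (aff_fun a a') size_cat ss size_drop.
  have := hJ s sS J (leqnn _) (take N v) _ u au.
  by rewrite -[X in verts X](size_takel le) mem_verts => /(_ isT); lia.
have mg : map_group (gen S).
  split; [exact: gen_id|exact: gen_comp|exact: gen_inv|exact: gen_treelike].
case: (pselect (forall x, exists2 h, gen S h & ~ loc_periodic h x)) => [np|].
  apply: nfr; have [a [a' [b [b' [[Ga Ga' Gb Gb'] c fw]]]]] := ping_pong mg inf np.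
  by exists a, a', b, b'; split=> //; split; exact: Ggen.
apply=> x; apply: contrapT => H; have [|F hF] := finite_orbit tS invS hN hJ (x0 := x).
  move=> h gh; apply: loc_periodic_loc_torsion; apply: contrapT => np; apply: H; by exists h.
by have [t gt] := inf x F; rewrite hF.
Qed.

Import Order.TTheory GRing.Theory Num.Theory.
Import numFieldNormedType.Exports.

Local Open Scope ring_scope.

(** * Coding the ternary Cantor set *)

Section Coding.
Context {R : realType}.
Variable lam : R.
Hypothesis hlam : 0 < lam < 1 / 2%:R.

Let lam0 : 0 < lam. Proof. by case/andP: hlam. Qed.
Let lam12 : lam + lam < 1.
Proof. by case/andP: hlam => _; rewrite ltr_pdivlMr ?ltr0n // mulr_natr mulr2n. Qed.
Let lam1 : lam < 1. Proof. by have := lam0; have := lam12; lra. Qed.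
Let le0l : 0 <= lam. Proof. exact: ltW. Qed.
Let pl n : 0 < lam ^+ n. Proof. exact: exprn_gt0. Qed.

(* The left end point of the interval of the construction indexed by [v]. *)
Fixpoint lep (v : seq bool) : R :=
  if v is b :: w then (if b then 1 - lam else 0) + lam * lep w else 0.

Lemma lep_bounds v : 0 <= lep v <= 1 - lam ^+ size v.
Proof.
elim: v => [|b v /andP[h1 h2]] /=; first by rewrite expr0 subrr lexx.
have h3 := mulr_ge0 le0l h1.
have h4 : lam * lep v <= lam - lam ^+ (size v).+1.
  by rewrite exprS -[X in X - _]mulr1 -mulrBr ler_pM2l.
by have := lam1; case: b => h5; apply/andP; split; lra.
Qed.

Lemma lep_cat v w : lep (v ++ w) = lep v + lam ^+ size v * lep w.
Proof.
elim: v => [|b v IH] /=; first by rewrite expr0 mul1r add0r.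
by rewrite IH exprS mulrDr addrA mulrA.
Qed.

Lemma lep_rcons v b : lep (rcons v b) = lep v + (if b then (1 - lam) * lam ^+ size v else 0).
Proof. by rewrite -cats1 lep_cat /= mulr0 addr0; case: b; rewrite ?mulr0 // mulrC. Qed.

Lemma lam_small (e : R) : 0 < e -> exists n, lam ^+ n < e.
Proof.
move=> e0; have l1 : `|lam| < 1 by rewrite ger0_norm.
have /cvgr0Pnorm_lt /(_ e e0) [n _ hn] := cvg_geometric (1 : R) l1.
exists n; have := hn n (leqnn n); rewrite /geometric /= mul1r ger0_norm //.
exact: ltW.
Qed.

Definition code (x : bits) : R := sup [set lep (pre n x) | n in [set: nat]].

Lemma code_bounds x n : lep (pre n x) <= code x <= lep (pre n x) + lam ^+ n.
Proof.
have ub m : lep (pre m x) <= lep (pre n x) + lam ^+ n.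
  case: (leqP n m) => c.
    have [s ss E] := pre_cat_ex n (m - n) x; rewrite subnKC // in E.
    rewrite E lep_cat size_pre lerD2l -[leRHS]mulr1 ler_pM2l //.
    by have /andP[_ h] := lep_bounds s; have := pl (size s); lra.
  have [s ss E] := pre_cat_ex m (n - m) x; rewrite subnKC ?(ltnW c) // in E.
  rewrite E lep_cat size_pre; have /andP[h _] := lep_bounds s.
  have := mulr_ge0 (ltW (pl m)) h; have := pl n; lra.
apply/andP; split; last by apply: ge_sup => [|_ [m _ <-]]; [exists (lep (pre 0 x)); exists 0%N|].
apply: ub_le_sup; last by exists n.
by exists (lep (pre n x) + lam ^+ n) => _ [m _ <-].
Qed.

Lemma code_unique x c n0 : (forall n, (n0 <= n)%N ->
  lep (pre n x) <= c <= lep (pre n x) + lam ^+ n) -> c = code x.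
Proof.
move=> H; apply/eqP/contraT => ne.
have e0 : 0 < `|c - code x| by rewrite normr_gt0 subr_eq0.
have [n hn] := lam_small e0.
have /andP[a1 a2] := H (n + n0)%N (leq_addl _ _).
have /andP[b1 b2] := code_bounds x (n + n0).
have le : lam ^+ (n + n0) <= lam ^+ n.
  by rewrite exprD ler_piMr ?(ltW (pl _)) // exprn_ile1 // ltW.
suff : `|c - code x| <= lam ^+ (n + n0) by lra.
rewrite ler_norml; apply/andP; split; lra.
Qed.

Lemma code_catb v y : code (catb v y) = lep v + lam ^+ size v * code y.
Proof.
apply/esym; apply: (@code_unique _ _ (size v)) => n le.
rewrite -(subnKC le) pre_catb_ge lep_cat exprD.
have /andP[h1 h2] := code_bounds y (n - size v).
apply/andP; split; first by rewrite lerD2l ler_pM2l.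
by rewrite -addrA lerD2l -mulrDr ler_pM2l.
Qed.

Lemma code01 x : 0 <= code x <= 1.
Proof. by have := code_bounds x 0; rewrite /= expr0 add0r. Qed.

Lemma code_true : code (fun=> true) = 1.
Proof.
apply/esym; apply: (@code_unique _ _ 0%N) => n _.
suff -> : lep (pre n (fun=> true)) = 1 - lam ^+ n.
  by rewrite subrK lexx andbT gerBl ltW.
elim: n => [|n IH]; first by rewrite expr0 subrr.
rewrite /pre /mkseq -addn1 iotaD map_cat cats1 lep_rcons -/(mkseq _ n) -/(pre n (fun=> true)).
by rewrite IH size_pre addn1 exprS; lra.
Qed.

Lemma code_false : code (fun=> false) = 0.
Proof.
apply/esym; apply: (@code_unique _ _ 0%N) => n _.
suff -> : lep (pre n (fun=> false)) = 0 by rewrite lexx add0r ltW.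
elim: n => [|n IH] //.
rewrite /pre /mkseq -addn1 iotaD map_cat cats1 lep_rcons -/(mkseq _ n) -/(pre n (fun=> false)).
by rewrite IH addr0.
Qed.

Lemma code_cyl x y n : pre n x = pre n y -> `|code x - code y| <= lam ^+ n.
Proof.
move=> E; have /andP[a1 a2] := code_bounds x n; have /andP[b1 b2] := code_bounds y n.
rewrite E in a1 a2; rewrite ler_norml; apply/andP; split; lra.
Qed.

(** The points lie in different halves of an interval of length [lam ^+ k], hence on either side of
    its central gap. *)
Lemma code_gap x y k : pre k x = pre k y -> x k = false -> y k = true ->
  (1 - 2 * lam) * lam ^+ k <= code y - code x.
Proof.
move=> E xk yk; have /andP[_ a] := code_bounds x k.+1; have /andP[b _] := code_bounds y k.+1.
have preS z : pre k.+1 z = rcons (pre k z) (z k).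
  by rewrite /pre /mkseq -addn1 iotaD map_cat cats1.
move: a b; rewrite !preS xk yk !lep_rcons E size_pre exprS.
by move=> a b; have : code y - code x >= (1 - lam) * lam ^+ k - lam * lam ^+ k; [lra|nra].
Qed.

Lemma first_diff (x y : bits) : x <> y -> exists k, pre k x = pre k y /\ x k <> y k.
Proof.
move=> ne; have ex : exists k, x k != y k.
  apply: contrapT => H; apply: ne; apply/funext => k; apply/eqP/contraT => h.
  by exfalso; apply: H; exists k.
exists (ex_minn ex); case: ex_minnP => k /eqP xk mn; split=> //.
apply/pre_eqP => i ik; apply/eqP/contraT => /mn; by rewrite leqNgt ik.
Qed.

Lemma code_gap_abs x y k : pre k x = pre k y -> x k <> y k ->
  (1 - 2 * lam) * lam ^+ k <= `|code x - code y|.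
Proof.
move=> E; case xk : (x k); case yk : (y k) => // _.
  by apply: le_trans (ler_norm _); apply: code_gap.
by rewrite distrC; apply: le_trans (ler_norm _); apply: code_gap.
Qed.

Lemma gap0 k : 0 < (1 - 2 * lam) * lam ^+ k.
Proof. by rewrite mulr_gt0 //; have := lam12; lra. Qed.

Lemma code_inj : injective code.
Proof.
move=> x y E; apply: contrapT => /first_diff[k [e n]].
by have := code_gap_abs e n; rewrite E subrr normr0; have := gap0 k; lra.
Qed.

Lemma mem_cantor_intervals n J :
  (J \in cantor_intervals lam n) <-> exists2 v, size v = n & J = (lep v, lep v + lam ^+ n).
Proof.
elim: n J => [|n IH] J /=.
  rewrite inE expr0; split=> [/eqP ->|[[|//] _ ->]]; last by rewrite /= add0r.
  by exists [::]; rewrite //= add0r.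
split.
  move=> /flatten_mapP[_ /IH[v sv ->]] /=; rewrite !inE => /orP[]/eqP ->.
    exists (rcons v false); rewrite ?size_rcons ?sv // lep_rcons addr0.
    by congr pair; rewrite ?exprS; lra.
  exists (rcons v true); rewrite ?size_rcons ?sv // lep_rcons sv.
  by congr pair; rewrite ?exprS; lra.
case=> v; case: (lastP v) => [//|{}v b]; rewrite size_rcons => -[sv] ->.
apply/flatten_mapP; exists (lep v, lep v + lam ^+ n); first by apply/IH; exists v.
rewrite !inE lep_rcons sv /=; case: b; apply/orP; [right|left]; apply/eqP; congr pair;
  rewrite ?exprS; lra.
Qed.

Lemma cantorE : cantor lam = [set code x | x in [set: bits]].
Proof.
apply/seteqP; split=> [t tC|_ [x _ <-] n _]; last first.
  exists (lep (pre n x), lep (pre n x) + lam ^+ n).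
    by apply/mem_cantor_intervals; exists (pre n x); rewrite ?size_pre.
  by rewrite /= in_itv /= code_bounds.
suff [x hx] : exists x, forall n, lep (pre n x) <= t <= lep (pre n x) + lam ^+ n.
  by exists x => //; apply/esym; apply: (@code_unique _ _ 0%N) => n _.
apply: contrapT => H.
have [||N hN] := @konig (fun v => ~~ (lep v <= t <= lep v + lam ^+ size v)).
- move=> v s; apply: contraNN; rewrite lep_cat size_cat exprD => /andP[h1 h2].
  have /andP[s1 s2] := lep_bounds s; have p := pl (size v).
  have h3 := mulr_ge0 (ltW p) s1.
  have h4 : lam ^+ size v * (lep s + lam ^+ size s) <= lam ^+ size v.
    by rewrite -[leRHS]mulr1 ler_pM2l //; lra.
  by rewrite mulrDr in h4; apply/andP; split; lra.
- move=> x; apply: contrapT => H'; apply: H; exists x => n.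
  by apply/contraT => h; exfalso; apply: H'; exists n; rewrite size_pre.
have [J /= /mem_cantor_intervals[v sv ->]] := tC N I; rewrite in_itv /= -sv => h.
by have := hN v; rewrite sv leqnn -sv h => /(_ isT).
Qed.

End Coding.

(** * Strictly differentiable maps of the Cantor set *)

Section LocalSimilarity.
Context {R : realType}.
Variable lam : R.
Hypothesis hlam : 0 < lam < 1 / 2%:R.

Let lam0 : 0 < lam. Proof. by case/andP: hlam. Qed.
Let lam12 : lam + lam < 1.
Proof. by case/andP: hlam => _; rewrite ltr_pdivlMr ?ltr0n // mulr_natr mulr2n. Qed.
Let lam1 : lam < 1. Proof. by have := lam0; have := lam12; lra. Qed.
Let pl n : 0 < lam ^+ n. Proof. exact: exprn_gt0. Qed.

Notation code := (code lam).

Lemma lam_le m n : (m <= n)%N -> lam ^+ n <= lam ^+ m.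
Proof. by move=> le; rewrite ler_wiXn2l // ltW. Qed.

Definition lip_on (h : bits -> bits) (n : nat) (x : bits) (D : R) : Prop :=
  forall y z, pre n y = pre n x -> pre n z = pre n x ->
    `|code (h y) - code (h z)| <= D * `|code y - code z|.

Definition strict_diff (h : bits -> bits) (x : bits) (d : R) : Prop :=
  forall e, 0 < e -> exists n, forall y z, pre n y = pre n x -> pre n z = pre n x ->
    `|code (h y) - code (h z) - d * (code y - code z)| <= e * `|code y - code z|.

Definition seq_continuous (h : bits -> bits) : Prop :=
  forall m x, exists n, forall y, pre n y = pre n x -> pre m (h y) = pre m (h x).

Definition diff_at (x y : bits) (k : nat) : Prop := pre k x = pre k y /\ x k <> y k.

Lemma preS n (x : bits) : pre n.+1 x = rcons (pre n x) (x n).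
Proof. by rewrite /pre /mkseq -addn1 iotaD map_cat cats1. Qed.

Lemma strict_diff_lip h x d D : strict_diff h x d -> `|d| < D ->
  exists n, lip_on h n x D.
Proof.
move=> sd lt; have [|n hn] := sd (D - `|d|); first by rewrite subr_gt0.
exists n => y z Ey Ez; have h1 := hn y z Ey Ez.
set u := code (h y) - code (h z) in h1 *; set t := code y - code z in h1 *.
have h2 : `|u| <= `|u - d * t| + `|d * t| by rewrite -{1}(subrK (d * t) u) ler_normD.
rewrite normrM in h2; rewrite mulrBl in h1; lra.
Qed.

(* In a cylinder of level [j], the two points around the central gap are
   [(1 - 2 lam) lam^j] apart, so no such gap can be torn by [h] to a gap of level
   [l]; hence all points of a cylinder of level [k] stay together up to [l]. *)
Lemma lip_first_diff h n x D a b y z k l : 0 <= D -> lip_on h n x D ->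
  D * lam ^+ b < lam ^+ a ->
  pre n y = pre n x -> pre n z = pre n x -> (n <= k)%N ->
  diff_at y z k -> diff_at (h y) (h z) l -> (k + a < l + b)%N.
Proof.
move=> D0 lip hD Ey Ez nk [Eyz _] [El dl]; rewrite ltnNge; apply/negP => le.
have small j : (k <= j)%N -> D * ((1 - 2 * lam) * lam ^+ j) < (1 - 2 * lam) * lam ^+ l.
  move=> kj; rewrite mulrCA ltr_pM2l; last by have := lam12; lra.
  apply: (@le_lt_trans _ _ (D * lam ^+ k)); first by rewrite ler_wpM2l // lam_le.
  rewrite -(ltr_pM2r (pl b)) mulrAC -exprD.
  apply: (@lt_le_trans _ _ (lam ^+ a * lam ^+ k)); first by rewrite ltr_pM2r.
  by rewrite -exprD lam_le // [X in (_ <= X)%N]addnC.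
pose side u := pre l.+1 (h u) == pre l.+1 (h y).
have sep u u' : side u -> ~~ side u' -> (1 - 2 * lam) * lam ^+ l <= `|code (h u) - code (h u')|.
  move=> /eqP su su'.
  have [|j [Ej dj]] := @first_diff (h u) (h u').
    by move=> E; move: su'; rewrite /side -E su eqxx.
  have jl : (j <= l)%N.
    rewrite leqNgt; apply/negP => lj; move: su'; rewrite /side -su => /eqP; apply.
    by apply/esym; exact: pre_le Ej.
  apply: le_trans (code_gap_abs hlam Ej dj).
  by rewrite ler_pM2l ?lam_le //; have := lam12; lra.
have sepD u u' : pre n u = pre n x -> pre n u' = pre n x -> side u -> ~~ side u' ->
    (1 - 2 * lam) * lam ^+ l <= D * `|code u - code u'|.
  by move=> e e' s s'; apply: le_trans (sep _ _ s s') (lip _ _ e e').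
have [m hm] : exists m, D * lam ^+ m < (1 - 2 * lam) * lam ^+ l.
  have [|m hm] := lam_small hlam (e := (1 - 2 * lam) * lam ^+ l / (D + 1)).
    by rewrite divr_gt0 // ?(gap0 hlam) // ltr_wpDl.
  exists m; rewrite ltr_pdivlMr ?ltr_wpDl // in hm; have := pl m; lra.
have Py u v : pre (size v) u = v -> (k <= size v)%N -> take k v = pre k y -> pre n u = pre n x.
  move=> Eu kv tv; rewrite -Ey; apply: (pre_le nk); rewrite -tv -Eu pre_take //.
(* Induction from fine cylinders to coarse ones. At depth [m] the Lipschitz bound alone excludes a
   change of side; above, each half lies on one side, and the end points [p] and [q] of the central
   gap are too close to have images on different sides. *)
have cst r v : (k <= size v)%N -> take k v = pre k y -> (m <= size v + r)%N ->
    forall u u', pre (size v) u = v -> pre (size v) u' = v -> side u = side u'.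
  elim: r v => [|r IH] v kv tv mv.
    suff W u u' : pre (size v) u = v -> pre (size v) u' = v -> side u -> side u'.
      by move=> u u' e e'; apply/idP/idP; exact: W.
    move=> e e' s; apply/contraT => s'.
    have := sepD u u' (Py _ _ e kv tv) (Py _ _ e' kv tv) s s'.
    have := @code_cyl _ lam hlam u u' (size v); rewrite e e' => /(_ erefl) c.
    have : D * `|code u - code u'| <= D * lam ^+ m.
      by rewrite ler_wpM2l //; apply: le_trans c _; rewrite lam_le // -[size v]addn0.
    lra.
  pose p := catb (rcons v false) (fun=> true); pose q := catb (rcons v true) (fun=> false).
  have szr c : size (rcons v c) = (size v).+1 by rewrite size_rcons.
  have vp : pre (size v) p = v by rewrite pre_catbW ?szr // -cats1 take_size_cat.
  have vq : pre (size v) q = v by rewrite pre_catbW ?szr // -cats1 take_size_cat.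
  have pq : `|code p - code q| = (1 - 2 * lam) * lam ^+ size v.
    rewrite /p /q !code_catb // code_true // code_false // !lep_rcons !szr exprS.
    rewrite distrC ger0_norm; last by have := gap0 hlam (size v); lra.
    by lra.
  have spq : side p = side q.
    have W u u' : pre n u = pre n x -> pre n u' = pre n x ->
        `|code u - code u'| = (1 - 2 * lam) * lam ^+ size v -> side u -> side u'.
      move=> e e' E s; apply/contraT => s'; have := sepD _ _ e e' s s'.
      by rewrite E; have := small _ kv; lra.
    have ep := Py _ _ vp kv tv; have eq := Py _ _ vq kv tv.
    by apply/idP/idP; apply: W => //; rewrite distrC.
  have child c u : pre (size v) u = v -> u (size v) = c -> side u = side p.
    move=> e uc; have e' : pre (size (rcons v c)) u = rcons v c by rewrite szr preS e uc.
    have IHc := IH (rcons v c); rewrite szr in IHc.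
    have kv' : (k <= (size v).+1)%N by rewrite ltnW.
    have tv' : take k (rcons v c) = pre k y by rewrite -cats1 takel_cat.
    have mv' : (m <= (size v).+1 + r)%N by rewrite addSn -addnS.
    rewrite szr in e'; case: c e' {uc} tv' IHc => e' tv' IHc; last first.
      by apply: (IHc kv' tv' mv') => //; rewrite -(szr false) pre_catb.
    by rewrite spq; apply: (IHc kv' tv' mv') => //; rewrite -(szr true) pre_catb.
  by move=> u u' e e'; rewrite (child _ u e erefl) (child _ u' e' erefl).
have := cst m (pre k y); rewrite size_pre leqnn pre_take // leq_addl.
move=> /(_ isT erefl isT y z erefl (esym Eyz)).
rewrite /side eqxx => /esym/eqP E; apply: dl.
by apply/esym; apply: (pre_eqP _ _ _).1 E _ _.
Qed.

(** The strict derivatives of [h] and of its inverse squeeze the level of the first difference: near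
    [x] it is shifted by one constant for all pairs of points. The sign of [d] then decides whether
    the bits are copied or complemented. *)
Lemma strict_diff_treelike h h' : cancel h h' -> cancel h' h ->
  seq_continuous h -> seq_continuous h' ->
  (forall x, exists d, strict_diff h x d) -> (forall x, exists d, strict_diff h' x d) ->
  treelike h.
Proof.
move=> hK h'K ch ch' sh sh' x.
have [d sd] := sh x; have [d' sd'] := sh' (h x).
have [flip hflip] : exists f : nat -> bits -> bits, forall k y, diff_at y (f k y) k.
  exists (fun k y i => if i == k then ~~ y i else y i) => k y; split.
    by apply/pre_eqP => i ik; rewrite ltn_eqF.
  by rewrite eqxx; case: (y k).
have d0 : d != 0.
  apply/eqP => d0; have [|n1 l1] := @strict_diff_lip _ _ _ (`|d'| + 1) sd'; first by rewrite ltrDl.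
  have D'0 : 0 < `|d'| + 1 by rewrite ltr_wpDl.
  have [n2 h2] := ch n1 x.
  have [|n3 h3] := sd ((`|d'| + 1)^-1 / 2); first by rewrite divr_gt0 // invr_gt0.
  have [Ey dy] := hflip (n2 + n3)%N x; set y := flip _ _ in Ey dy.
  have E2 : pre n2 y = pre n2 x by apply/esym; apply: pre_le Ey; rewrite leq_addr.
  have E3 : pre n3 y = pre n3 x by apply/esym; apply: pre_le Ey; rewrite leq_addl.
  have := h3 x y erefl E3; rewrite d0 mul0r subr0 => h4.
  have := l1 (h x) (h y) erefl (h2 y E2); rewrite !hK => h5.
  have := code_gap_abs hlam Ey dy; have := gap0 hlam (n2 + n3) => g0 g1.
  have : (`|d'| + 1) * `|code (h x) - code (h y)| <= `|code x - code y| / 2.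
    by rewrite -ler_pdivlMl //; apply: le_trans h4 _; lra.
  lra.
have ad0 : 0 < `|d| by rewrite normr_gt0.
(* This locates [|d|] between two consecutive powers of [lam]; the factor [lam ^+ b] keeps the
   exponents natural. *)
have [a [b [ab1 ab2]]] : exists a b, lam ^+ a.+1 <= `|d| * lam ^+ b /\ `|d| * lam ^+ b < lam ^+ a.
  have [|b hb] := lam_small hlam (e := `|d|^-1); first by rewrite invr_gt0.
  have db1 : `|d| * lam ^+ b < 1 by move: hb; rewrite -(ltr_pM2l ad0) mulfV // gt_eqF.
  have [|m hm] := lam_small hlam (e := `|d| * lam ^+ b); first by rewrite mulr_gt0.
  have ex : exists m, lam ^+ m <= `|d| * lam ^+ b by exists m; exact: ltW.
  case: (ex_minnP ex) => -[|m'] hm' mn; first by rewrite expr0 in hm'; lra.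
  exists m', b; split=> //; rewrite ltNge; apply/negP => /mn; by rewrite ltnn.
have [|n1 l1] := @strict_diff_lip _ _ _ ((`|d| + lam ^+ a / lam ^+ b) / 2) sd.
  have c : `|d| < lam ^+ a / lam ^+ b by rewrite ltr_pdivlMr.
  by lra.
have D1 : (`|d| + lam ^+ a / lam ^+ b) / 2 * lam ^+ b < lam ^+ a.
  by rewrite mulrAC mulrDl divfK ?gt_eqF //; lra.
set D := (_ / 2) in l1 D1; have Dp : 0 <= D.
  by rewrite divr_ge0 // addr_ge0 // divr_ge0 // ltW.
(* Since [|d| - e] still exceeds [|d| * lam], [lip_first_diff] applies to the inverse with exponent
   [a.+2]. Together with the bound for [h] this leaves only the shift by [a.+1 - b]. *)
pose e := `|d| * (1 - lam) / 2.
have e0 : 0 < e by rewrite divr_gt0 // mulr_gt0 //; have := lam1; lra.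
have ed : `|d| - e > `|d| * lam.
  rewrite /e; have : 0 < `|d| * (1 - lam) by rewrite mulr_gt0 //; have := lam1; lra.
  lra.
have edp : 0 < `|d| - e by apply: lt_trans ed; rewrite mulr_gt0.
have [n2 h2] := sd e e0.
have low y z : pre n2 y = pre n2 x -> pre n2 z = pre n2 x ->
    (`|d| - e) * `|code y - code z| <= `|code (h y) - code (h z)|.
  move=> Ey Ez; have h3 := h2 y z Ey Ez.
  set u := code (h y) - code (h z) in h3 *; set t := code y - code z in h3 *.
  have h4 : `|d * t| <= `|u| + `|u - d * t|.
    by rewrite -[X in `|X|](subKr u (d * t)) ler_normB.
  rewrite normrM in h4; rewrite mulrBl; lra.
have [n3 h3] := ch' n2 (h x); rewrite hK in h3.
have l2 : lip_on h' n3 (h x) (`|d| - e)^-1.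
  move=> y z /h3 Ey /h3 Ez; have := low _ _ Ey Ez; rewrite !h'K.
  by rewrite -ler_pdivlMl.
have D2 : (`|d| - e)^-1 * lam ^+ a.+2 < lam ^+ b.
  rewrite mulrC ltr_pdivrMr // exprSr.
  apply: (@le_lt_trans _ _ (lam ^+ b * (`|d| * lam))).
    by rewrite mulrA ler_pM2r // mulrC.
  by rewrite ltr_pM2l.
have [n4 h4] := ch n3 x.
pose n := (n1 + n2 + n4)%N.
have E1 y : pre n y = pre n x -> pre n1 y = pre n1 x by apply: pre_le; rewrite /n; clear; lia.
have E2 y : pre n y = pre n x -> pre n2 y = pre n2 x by apply: pre_le; rewrite /n; clear; lia.
have E3 y : pre n y = pre n x -> pre n3 (h y) = pre n3 (h x).
  by move=> E; apply: h4; apply: pre_le E; rewrite /n; clear; lia.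
have diffn y z k : pre n y = pre n x -> pre n z = pre n x -> diff_at y z k -> (n <= k)%N.
  move=> Ey Ez [_ dk]; rewrite leqNgt; apply/negP => kn; apply: dk.
  by apply: (pre_eqP n y z).1 => //; rewrite Ey Ez.
have n3l y z l : pre n3 y = pre n3 (h x) -> pre n3 z = pre n3 (h x) -> diff_at y z l -> (n3 <= l)%N.
  move=> Ey Ez [_ dk]; rewrite leqNgt; apply/negP => kn; apply: dk.
  by apply: (pre_eqP n3 y z).1 => //; rewrite Ey Ez.
have level y z k l : pre n y = pre n x -> pre n z = pre n x ->
    diff_at y z k -> diff_at (h y) (h z) l -> (l + b = k + a.+1)%N.
  move=> Ey Ez dk dl.
  have nk := diffn _ _ _ Ey Ez dk.
  have nl := n3l _ _ _ (E3 _ Ey) (E3 _ Ez) dl.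
  have n1k : (n1 <= k)%N by apply: leq_trans nk; rewrite /n; clear; lia.
  have f1 := lip_first_diff Dp l1 D1 (E1 _ Ey) (E1 _ Ez) n1k dk dl.
  have i0 : 0 <= (`|d| - e)^-1 by rewrite invr_ge0 ltW.
  have := lip_first_diff i0 l2 D2 (E3 _ Ey) (E3 _ Ez) nl dl.
  by rewrite !hK => /(_ _ dk) f2; clear - f1 f2; lia.
have fd y z k : pre n y = pre n x -> pre n z = pre n x -> diff_at y z k ->
    exists2 l, (l + b = k + a.+1)%N & diff_at (h y) (h z) l.
  move=> Ey Ez dk; have [|l dl] := @first_diff (h y) (h z).
    by move=> /(can_inj hK) E; case: dk; rewrite E.
  by exists l => //; exact: (level y z).
have incr y z k l : pre n y = pre n x -> pre n z = pre n x -> diff_at y z k ->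
    diff_at (h y) (h z) l -> y k = false -> h y l = (d < 0).
  move=> Ey Ez [Ek dk] [El dl] yk.
  have zk : z k = true by move: dk; rewrite yk; case: (z k).
  have c1 : 0 < code z - code y by apply: lt_le_trans (code_gap hlam Ek yk zk); exact: gap0.
  have := h2 z y (E2 _ Ez) (E2 _ Ey); rewrite (gtr0_norm c1) ler_norml => /andP[g1 g2].
  have ec : e * (code z - code y) < `|d| * (code z - code y).
    by rewrite ltr_pM2r //; have := mulr_gt0 ad0 lam0; lra.
  case: (ltP d 0) => sgn.
    apply/negPn/negP => /negbTE hy; have hz : h z l = true.
      by move: dl; rewrite hy; case: (h z l).
    have := code_gap hlam El hy hz; have := gap0 hlam l.
    by rewrite (ltr0_norm sgn) in ec; lra.
  apply/negbTE/negP => hy; have hz : h z l = false by move: dl; rewrite hy; case: (h z l).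
  have := code_gap hlam (esym El) hz hy; have := gap0 hlam l.
  by rewrite (ger0_norm sgn) in ec; lra.
(* The image level [l0] of a first difference at level [n] is the length of the target word. Points
   of the cylinder first differ at level [n] or later, so their images agree before [l0]; flipping
   bit [n + (i - l0)] isolates bit [i] of the image. *)
have [l0 l0E _] : exists2 l, (l + b = n + a.+1)%N & diff_at (h x) (h (flip n x)) l.
  by apply: fd => //; case: (hflip n x).
exists n, (pre l0 (h x)), (d < 0) => y.
have Ecy y' : pre n (catb (pre n x) y') = pre n x by rewrite -{1}(size_pre n x) pre_catb.
apply/funext => i; rewrite {2}/catb size_pre; case: (ltnP i l0) => il.
  rewrite nth_pre //; case: (pselect (catb (pre n x) y = x)) => [-> //|/first_diff[k dk]].
  have [l lE [El _]] := fd _ _ _ (Ecy y) (erefl _) dk.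
  have nk := diffn _ _ _ (Ecy y) (erefl _) dk.
  by apply: (pre_eqP _ _ _).1 El _ _; clear - il lE nk l0E; lia.
set Y := catb (pre n x) y; pose k := (n + (i - l0))%N.
have Yk : Y k = y (i - l0)%N by rewrite /Y /catb size_pre /k ltnNge leq_addr /= addKn.
have dk := hflip k Y; have dk' : diff_at (flip k Y) Y k by split; [exact: esym (proj1 dk)|move=> E; apply: (proj2 dk); rewrite E].
have Ef : pre n (flip k Y) = pre n x.
  by rewrite -(Ecy y); apply/esym; apply: (pre_le _ dk.1); rewrite leq_addr.
rewrite /xb -Yk; have [l lE dl] := fd _ _ _ (Ecy y) Ef dk.
have il' : l = i by rewrite /k in lE; clear - lE il l0E; lia.
rewrite {l lE}il' in dl.
have dl' : diff_at (h (flip k Y)) (h Y) i by split; [exact: esym (proj1 dl)|move=> E; apply: (proj2 dl); rewrite E].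
case YK : (Y k).
  have fk : flip k Y k = false by case: dk => _; rewrite YK; case: (flip k Y k).
  have := incr _ _ _ _ Ef (Ecy y) dk' dl' fk; case: dl => _ dl hf.
  by rewrite addbT -hf; move: dl; case: (h Y i); case: (h (flip k Y) i).
by rewrite addbF; exact: incr (Ecy y) Ef dk dl YK.
Qed.

End LocalSimilarity.

(** * Strict differentiability from continuous derivatives *)

Section StrictDifferentiability.
Context {R : realType}.

Definition strict_derive (h : R -> R) (t d : R) : Prop :=
  forall e, 0 < e -> exists2 r, 0 < r & forall y z, `|y - t| < r -> `|z - t| < r ->
    `|h y - h z - d * (y - z)| <= e * `|y - z|.

Lemma C1_strict_derive (h dh : R -> R) (t : R) :
  (\forall s \near t, is_derive (s : R) (1 : R) h (dh s)) -> {for t, continuous dh} ->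
  strict_derive h t (dh t).
Proof.
move=> der cont e e0.
have cn : \forall s \near t, `|dh s - dh t| < e.
  by move/cvgrPdist_lt: cont => /(_ e e0); apply: filterS => s; rewrite distrC.
have /nbhs_ballP[r /= r0 hr] : \forall s \near t,
    is_derive (s : R) (1 : R) h (dh s) /\ `|dh s - dh t| < e by exact: filterI.
have hr' s : `|s - t| < r -> is_derive s (1 : R) h (dh s) /\ `|dh s - dh t| < e.
  by move=> st; apply: hr; rewrite /ball /= distrC.
exists r => // y z; wlog yz : y z / z <= y.
  move=> W yt zt; case: (leP z y) => c; first exact: W.
  have := W z y (ltW c) zt yt; rewrite (distrC z y); congr (_ <= _).
  by rewrite -normrN; congr `|_|; lra.
move=> yt zt.
have bt s : s \in `[z, y] -> `|s - t| < r.
  rewrite in_itv /= => /andP[zs sy]; move: yt zt; rewrite !ltr_norml.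
  by move=> /andP[_ y2] /andP[z1 _]; apply/andP; split; lra.
have [||c cz ->] := @MVT_segment _ h dh z y yz.
- by move=> s sz; apply: (hr' s _).1; apply: bt; apply: subset_itv_oo_cc.
- apply: derivable_within_continuous => s /bt /hr'[ds _]; exact: ex_derive.
rewrite -mulrBl normrM ler_wpM2r //; exact: ltW (hr' c (bt c cz)).2.
Qed.

Lemma smooth_curve_strict (U : set R) (u : R -> 'rV[R]_2) (t : R) i :
  smooth_on U u -> nbhs t U ->
  strict_derive (fun s => u s 0 i) t (('D_1 u t) 0 i).
Proof.
move=> su Ut; apply: (@C1_strict_derive _ (fun s => ('D_1 u s) 0 i)).
  apply: filterS Ut => s Us; have /diff_derivable du := su [::] s Us.
  have ds : derivable u s 1 by exact: du.
  apply: DeriveDef; first exact: (derivable_mxP _ _ _).1.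
  by rewrite derive_mx // mxE.
have dd := su [:: 1] t (nbhs_singleton Ut).
have := differentiable_continuous (differentiable_comp dd (differentiable_coord _ 0 i)).
exact.
Qed.

(** The chain rule, with the differential of [F] expanded in coordinate directions so that its
    continuity along the curve follows from smoothness of [F]. *)
Lemma smooth_comp_strict (U : set R) (O : set 'rV[R]_2) (u : R -> 'rV[R]_2)
  (F : 'rV[R]_2 -> 'rV[R]_2) (t : R) i :
  smooth_on U u -> smooth_on O F -> nbhs t U -> (\forall s \near t, O (u s)) ->
  exists d, strict_derive (fun s => F (u s) 0 i) t d.
Proof.
move=> su sF Ut Ot.
pose dh (s : R) := \sum_j ('D_1 u s) 0 j * ('D_(delta_mx 0 j) F (u s)) 0 i.
exists (dh t); apply: C1_strict_derive.
  near=> s.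
  have du : differentiable u s by apply: (su [::]); near: s.
  have dF : differentiable F (u s) by apply: (sF [::]); near: s.
  have dFu : differentiable (F \o u) s by exact: differentiable_comp.
  have dv : derivable (F \o u) s 1 by exact: diff_derivable.
  apply: DeriveDef; first exact: ((derivable_mxP (F \o u) s 1).1 dv 0 i).
  have := derive_mx dv => /matrixP /(_ 0 i); rewrite mxE => <-.
  have -> : 'D_1 (F \o u) s = 'd F (u s) ('D_1 u s).
    by rewrite (deriveE _ dFu) diff_comp //= (deriveE _ du).
  rewrite [X in 'd F _ X]row_sum_delta linear_sum summxE; apply: eq_bigr => j _.
  by rewrite linearZ /= mxE (deriveE _ dF).
have ut : {for t, continuous u}.
  exact: (differentiable_continuous (su [::] t (nbhs_singleton Ut))).
apply: cvg_big => [|j _]; first exact: add_continuous.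
apply: cvgM.
  have dd := su [:: 1] t (nbhs_singleton Ut).
  exact: (differentiable_continuous (differentiable_comp dd (differentiable_coord _ 0 j))).
have dd := sF [:: delta_mx 0 j] (u t) (nbhs_singleton Ot).
have := differentiable_continuous (differentiable_comp dd (differentiable_coord _ 0 i)).
exact: (@continuous_comp _ _ _ u (fun p => ('D_(delta_mx 0 j) F p) 0 i) t ut).
Unshelve. all: by end_near. Qed.

End StrictDifferentiability.

(** * The Cantor set in the surface *)

Section CantorInSurface.
Context {R : realType} {S : surface R}.
Variable lam : R.
Hypothesis hlam : 0 < lam < 1 / 2%:R.
Variable g : R -> S.
Hypothesis hg : smooth_segment g.

Definition point_of (x : bits) : S := g (code lam x).

Lemma code_itv x : code lam x \in `[0, 1].
Proof. by rewrite in_itv /= code01. Qed.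

Lemma point_of_inj : injective point_of.
Proof.
case: hg => e _ [_ _ inj _] x y /inj E; apply: (code_inj hlam); apply: E; exact: code_itv.
Qed.

Lemma cantor_imageE : g @` cantor lam = [set point_of x | x in [set: bits]].
Proof.
rewrite cantorE //; apply/seteqP; split=> [_ [_ [x _ <-] <-]|_ [x _ <-]]; first by exists x.
by exists (code lam x) => //; exists x.
Qed.

Lemma code_near x (V : set R) : nbhs (code lam x) V ->
  exists n, forall y, pre n y = pre n x -> V (code lam y).
Proof.
move=> /nbhs_ballP[r /= r0 hr]; have [n hn] := lam_small hlam r0.
exists n => y E; apply: hr; rewrite /ball /=; apply: le_lt_trans hn.
exact: code_cyl.
Qed.

Lemma segment_cont x : {for code lam x, continuous g}.
Proof.
case: hg => e e0 [+ _ _ _]; apply; have := code_itv x.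
rewrite !in_itv /= => /andP[h1 h2]; apply/andP; split; lra.
Qed.

Lemma point_of_near x (V : set S) : nbhs (point_of x) V ->
  exists n, forall y, pre n y = pre n x -> V (point_of y).
Proof. by move=> /(@segment_cont x) /code_near. Qed.

(** The image of a compact set in a Hausdorff space; [konig] provides the finite subcover by
    cylinders separated from [s]. *)
Lemma clopen_closed n (P : set (seq bool)) :
  closed [set point_of y | y in [set y | P (pre n y)]].
Proof.
rewrite -[X in closed X]setCK; apply: open_closedC; rewrite openE => s hs.
have [||N hN] := @konig (fun v => exists2 V, nbhs s V &
    forall y, pre (size v) y = v -> P (pre n y) -> ~ V (point_of y)).
- move=> v w [V sV hV]; exists V => // y E; apply: hV.
  by rewrite -(@pre_take _ (size (v ++ w))) ?E ?take_size_cat // size_cat leq_addr.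
- move=> x; case: (pselect (P (pre n x))) => [Px|nP]; last first.
    exists n, setT; first exact: filterT.
    by move=> y; rewrite size_pre => ->.
  have ne : point_of x != s by apply/eqP => E; apply: hs; exists x.
  have := @surf_hausdorff _ S; rewrite open_hausdorff => /(_ _ _ ne).
  move=> [[A B] /= [/set_mem xA /set_mem sB] [oA oB /eqP AB]].
  have [m hm] := point_of_near (open_nbhs_nbhs (conj oA xA)).
  exists m, B; first exact: open_nbhs_nbhs.
  move=> y; rewrite size_pre => /hm Ay _ By.
  by have : (A `&` B) (point_of y) by []; rewrite AB.
have /choice[V hV] v : exists V, size v = N -> nbhs s V /\
    forall y, pre (size v) y = v -> P (pre n y) -> ~ V (point_of y).
  case: (pselect (size v = N)) => [e|ne]; last by exists setT => /ne.
  by have [|W sW hW] := hN v; [rewrite e|exists W].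
have : nbhs s [set t | forall v, v \in verts N -> V v t].
  have : forall v, v \in verts N -> nbhs s (V v).
    by move=> v /mem_vertsP /hV[].
  elim: (verts N) => [_|v l IH H]; first by apply: filterS filterT => t _ v.
  have Hv := H v (mem_head _ _).
  have Hl := IH (fun w wl => H w (mem_behead (s := v :: l) wl)).
  apply: filterS (filterI Hv Hl) => t [tv tl] w; rewrite in_cons => /orP[/eqP->//|]; exact: tl.
apply: filterS => t ht [y /= Py E]; have := ht _ (verts_pre N y); rewrite -E.
by apply: (hV _ _).2 => //; rewrite size_pre.
Qed.

Lemma point_of_open n x : exists2 V : set S, open V &
  forall y, V (point_of y) <-> pre n y = pre n x.
Proof.
exists (~` [set point_of y | y in [set y | ~ pre n y = pre n x]]).
  by apply: closed_openC; exact: (@clopen_closed n (fun v => ~ v = pre n x)).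
move=> y; split=> [ny|Ey [z /= nz /point_of_inj E]]; last by rewrite E in nz.
by apply: contrapT => h; apply: ny; exists y.
Qed.

Section Induced.
Variables (f : smooth_map S S) (h : bits -> bits).
Hypothesis fh : forall x, f (point_of x) = point_of (h x).

Lemma induced_continuous : seq_continuous h.
Proof.
move=> m x; have [V oV hV] := point_of_open m (h x).
have Vx : V (point_of (h x)) by apply/hV.
have fx : {for point_of x, continuous f} by apply: (smooth_funP f).1.
rewrite -fh in Vx; have := fx V (open_nbhs_nbhs (conj oV Vx)).
by move=> /point_of_near[n hn]; exists n => y /hn /=; rewrite fh => /hV.
Qed.

(** In a chart at the image point some coordinate [k] of the segment has nonzero velocity [kap].
    Since [k] at the code of [h y] equals [hh] at the code of [y], and [hh] has strict derivative
    [eta], the quotient [eta / kap] is the derivative. *)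
Lemma induced_strict x : exists d, strict_diff lam h x d.
Proof.
have [e e0 [gc gs _ gi]] := hg.
have [c Ac cx] := @atlas_cover _ S (point_of x).
have [c' Ac' cx'] := @atlas_cover _ S (point_of (h x)).
pose t := code lam x; pose t' := code lam (h x).
have itv y : code lam y \in `](- e), (1 + e)[.
  by have := code_itv y; rewrite !in_itv /= => /andP[h1 h2]; apply/andP; split; lra.
pose U (k : chart R S) : set R := [set` `](- e), (1 + e)[] `&` (g @^-1` chart_dom k).
have nU k y : chart_dom k (point_of y) -> nbhs (code lam y) (U k).
  move=> ky; apply: filterI; first exact: near_in_itvoo.
  by apply: (@segment_cont y); exact: open_nbhs_nbhs (conj (@chart_dom_open _ _ k) ky).
have [i hi] : exists i, ('D_1 (chart_to c' \o g) t') 0 i != 0.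
  have := gi c' Ac' t' (code_itv _) cx' => /rV0Pn[i]; by exists i.
have sk := smooth_curve_strict i (gs c' Ac') (nU c' _ cx').
pose kap := ('D_(1 : R) (chart_to c' \o g) t') 0 i; rewrite -/kap in hi sk.
have [|eta sh] := smooth_comp_strict i (gs c Ac) ((smooth_funP f).2 c c' Ac Ac') (nU c x cx).
  have nf : nbhs (point_of x) (f @^-1` chart_dom c').
    have fx : {for point_of x, continuous f} by apply: (smooth_funP f).1.
    by apply: fx; apply: open_nbhs_nbhs; split; [exact: chart_dom_open|rewrite fh].
  have := @segment_cont x _ nf; move: (nU c x cx) => n1 n2.
  apply: filterS (filterI n1 n2) => s [[_ cs] fs]; exists (g s) => //.
pose k (s : R) := chart_to c' (g s) 0 i.
pose hh (s : R) := local_rep c c' f (chart_to c (g s)) 0 i.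
have hhE y : chart_dom c (point_of y) -> hh (code lam y) = k (code lam (h y)).
  by move=> cy; rewrite /hh /k /local_rep /= chart_toK // -/(point_of y) fh.
have kap0 : 0 < `|kap| by rewrite normr_gt0.
have close z (r : R) : 0 < r -> exists n, forall y, pre n y = pre n z ->
    `|code lam y - code lam z| < r.
  by move=> r0; have [n hn] := lam_small hlam r0; exists n => y E; exact: le_lt_trans (code_cyl _ E) hn.
have [n0 hn0] := point_of_near (open_nbhs_nbhs (conj (@chart_dom_open _ _ c) cx)).
exists (eta / kap) => ep ep0.
pose q := ep * `|kap| / 2.
pose q1 := `|kap| / 2.
(* A crude Lipschitz constant for [h] near [x], from the estimate with tolerance [q1]; it converts
   errors relative to image distances into errors relative to source distances. *)
pose C := 2 * (`|eta| + 1) / `|kap|.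
have C0 : 0 < C by rewrite divr_gt0 // mulr_gt0 // ltr_wpDl.
have q1p : 0 < q1 by rewrite divr_gt0.
have qp : 0 < q by rewrite divr_gt0 // mulr_gt0.
have [r1 r10 hr1] := sk _ q1p.
have [r2 r20 hr2] := sh 1 ltr01.
have [r3 r30 hr3] := sk (q / C) (divr_gt0 qp C0).
have [r4 r40 hr4] := sh q qp.
have [n1 h1] := close (h x) _ r10; have [m1 g1] := induced_continuous n1 x.
have [n2 h2] := close x _ r20.
have [n3 h3] := close (h x) _ r30; have [m3 g3] := induced_continuous n3 x.
have [n4 h4] := close x _ r40.
exists (n0 + m1 + n2 + m3 + n4)%N => y z Ey Ez.
have le0 : (n0 <= n0 + m1 + n2 + m3 + n4)%N by clear; lia.
have le1 : (m1 <= n0 + m1 + n2 + m3 + n4)%N by clear; lia.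
have le2 : (n2 <= n0 + m1 + n2 + m3 + n4)%N by clear; lia.
have le3 : (m3 <= n0 + m1 + n2 + m3 + n4)%N by clear; lia.
have le4 : (n4 <= n0 + m1 + n2 + m3 + n4)%N by clear; lia.
have cy := hn0 _ (pre_le le0 Ey); have cz := hn0 _ (pre_le le0 Ez).
have b1 := hr1 _ _ (h1 _ (g1 _ (pre_le le1 Ey))) (h1 _ (g1 _ (pre_le le1 Ez))).
have b2 := hr2 _ _ (h2 _ (pre_le le2 Ey)) (h2 _ (pre_le le2 Ez)).
have b3 := hr3 _ _ (h3 _ (g3 _ (pre_le le3 Ey))) (h3 _ (g3 _ (pre_le le3 Ez))).
have b4 := hr4 _ _ (h4 _ (pre_le le4 Ey)) (h4 _ (pre_le le4 Ez)).
rewrite -/(hh _) -/(hh _) !hhE // in b2 b4.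
rewrite -/(k _) -/(k _) in b1 b3.
set K := k _ - k _ in b1 b2 b3 b4.
set D := code lam (h y) - code lam (h z) in b1 b3 *.
set T := code lam y - code lam z in b2 b4 *.
have a1 : `|kap * D| <= `|K| + `|K - kap * D|.
  by rewrite -[X in `|X|](subKr K (kap * D)) ler_normB.
have a2 : `|K| <= `|K - eta * T| + `|eta * T| by rewrite -{1}(subrK (eta * T) K) ler_normD.
have DT : `|D| <= C * `|T|.
  rewrite normrM in a1; rewrite normrM in a2.
  rewrite /C mulrAC ler_pdivlMr //; rewrite /q1 in b1; lra.
have b3' : `|K - kap * D| <= q * `|T|.
  apply: le_trans b3 _; rewrite -mulrA ler_pM2l // ler_pdivrMl //.
have b5 : `|kap * D - eta * T| <= 2 * q * `|T|.
  have -> : kap * D - eta * T = (K - eta * T) - (K - kap * D) by lra.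
  apply: le_trans (ler_normB _ _) _; lra.
have -> : D - eta / kap * T = kap^-1 * (kap * D - eta * T).
  by rewrite [RHS]mulrBr mulKf // mulrA [eta / _]mulrC.
rewrite normrM normfV ler_pdivrMl //; apply: le_trans b5 _; rewrite /q; lra.
Qed.

End Induced.

(** Closeness of order 0 on the compact set [[set p]], in a chart at the image, already controls the
    value at [p]. *)
Lemma evaluation_open (p : S) (V : set S) : open V -> open [set m : smooth_map S S | V (m p)].
Proof.
move=> oV; rewrite openE => m /= Vm.
have [c Ac cp] := @atlas_cover _ S p; have [c' Ac' cp'] := @atlas_cover _ S (m p).
have cf : chart_from c' z @[z --> chart_to c' (m p)] -->
  chart_from c' (chart_to c' (m p)) := chart_from_cont cp'.
rewrite chart_toK // in cf.
have /nbhs_ballP[r /= r0 hr] := cf V (open_nbhs_nbhs (conj oV Vm)).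
have nm : nbhs m (Cinf_nbhd m c c' [set p] 0 r).
  rewrite nbhsE; exists (Cinf_nbhd m c c' [set p] 0 r) => //; split.
    exists [set Cinf_nbhd m c c' [set p] 0 r]; last by rewrite bigcup_set1.
    move=> _ ->; exists [fset Cinf_nbhd m c c' [set p] 0 r]%fset; last first.
      by rewrite set_fset1 bigcap_set1.
    move=> _ /fset1P ->; apply/mem_set.
    exists m, c, c', [set p], 0%N, r; split=> //; first exact: compact_set1.
      by move=> _ ->.
    by move=> _ [_ -> <-].
  split=> [_ [_ -> <-] //|_ -> s _ _]; by rewrite subrr normr0.
apply: filterS nm => m' [sub cl].
have m'p : chart_dom c' (m' p) by apply: sub; exists p.
rewrite /= -(chart_toK m'p); apply: hr; rewrite -ball_normE /= distrC.
have := cl p erefl [::] (leqnn _) => /=; rewrite /local_rep /= chart_toK //.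
exact.
Qed.

(** In a connected set of diffeomorphisms that preserve the Cantor set and include the identity,
    those keeping the point in a given cylinder around it form a nonempty clopen subset, hence
    everything. *)
Lemma Diff0_fixes (d : smooth_map S S) x :
  Diff0 (g @` cantor lam) d -> d (point_of x) = point_of x.
Proof.
move=> [B [Bid BD cB] Bd].
apply: contrapT => ne.
have inK m : B m -> exists y, m (point_of x) = point_of y.
  move=> /BD[_ _ mK].
  have : [set m z | z in g @` cantor lam] (m (point_of x)).
    by exists (point_of x) => //; rewrite cantor_imageE; exists x.
  by rewrite mK cantor_imageE => -[y _ <-]; exists y.
have [y dy] := inK d Bd.
have [n nyx] : exists n, pre n y <> pre n x.
  apply: contrapT => H; apply: ne; rewrite dy; congr point_of; apply: bits_eq => n.
  by apply: contrapT => h; apply: H; exists n.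
have [V oV hV] := point_of_open n x.
have E : B `&` [set m | V (m (point_of x))] = B.
  apply: cB; first by exists (smooth_id S); split=> //; apply/hV.
    by exists [set m : smooth_map S S | V (m (point_of x))] => //; exact: evaluation_open.
  exists (~` [set m : smooth_map S S |
      (~` [set point_of z | z in [set z | pre n z = pre n x]]) (m (point_of x))]).
    apply: open_closedC; apply: evaluation_open; apply: closed_openC.
    exact: (@clopen_closed n (fun v => v = pre n x)).
  apply/seteqP; split=> m [Bm]; rewrite /setC /=.
    have [z ->] := inK m Bm; move=> /hV Ez; split=> //.
    by apply; exists z.
  by move=> /contrapT[z /= Ez E]; split=> //; rewrite -E; apply/hV.
have : (B `&` [set m | V (m (point_of x))]) d by rewrite E.
by move=> [_ /=]; rewrite dy => /hV.
Qed.

End CantorInSurface.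

(** * Invariant measures *)

Lemma ultra_fmap (T T' : Type) (f : T -> T') (U : set_system T) :
  UltraFilter U -> UltraFilter (f @ U).
Proof.
move=> UU; have PU : ProperFilter U by exact: ultra_proper.
split; first exact: fmap_proper_filter.
move=> V PV sub; apply/seteqP; split; last exact: sub.
move=> A VA; have [//|nA] := in_ultra_setVsetC (f @^-1` A) UU.
have /filter_ex[y []] : V (A `&` ~` A) by apply: filterI => //; exact: sub.
by [].
Qed.

Section InvariantMean.
Context {R : realType}.
Variable G : set (bits -> bits).
Hypothesis injG : forall h, G h -> injective h.
Hypothesis orbG : forall S : seq (bits -> bits), (forall s, s \in S -> G s) ->
  exists x (F : seq bits), forall h, gen S h -> h x \in F.

Lemma invariant_orbit (S : seq (bits -> bits)) : (forall s, s \in S -> G s) ->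
  exists O : seq bits, [/\ uniq O, O <> [::] & forall s, s \in S -> perm_eq (map s O) O].
Proof.
move=> GS; have [x [F hF]] := orbG GS.
pose O := [seq y <- undup F | `[< exists2 h, gen S h & h x = y >]].
have inO y : (exists2 h, gen S h & h x = y) -> y \in O.
  move=> ex; rewrite mem_filter mem_undup; apply/andP; split; first exact/asboolP.
  by case: ex => h gh <-; exact: hF.
have uO : uniq O by rewrite filter_uniq // undup_uniq.
exists O; split=> //.
  by move=> E; have := inO x (ex_intro2 _ _ id (gen_id S) erefl); rewrite E.
move=> s sS; have us : uniq (map s O) by rewrite map_inj_uniq //; exact: injG (GS _ sS).
have sub : {subset map s O <= O}.
  move=> _ /mapP[y + ->]; rewrite mem_filter => /andP[/asboolP[h gh <-] _].
  by apply: inO; exists (s \o h) => //; exact: gen_step.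
have [_ E] := uniq_min_size us sub (eq_leq (esym (size_map s O))).
exact: uniq_perm.
Qed.

Definition freq (O : seq bits) (Y : set bits) : R :=
  (count (fun y => `[< Y y >]) O)%:R / (size O)%:R.

Lemma freq_ge0 O Y : 0 <= freq O Y.
Proof. by rewrite divr_ge0. Qed.

Lemma freq_le1 O Y : freq O Y <= 1.
Proof.
rewrite /freq; case: O => [|y O]; first by rewrite mul0r.
by rewrite ler_pdivrMr ?ltr0n // mul1r ler_nat count_size.
Qed.

Lemma freqU O A B : A `&` B = set0 -> freq O (A `|` B) = freq O A + freq O B.
Proof.
move=> AB; rewrite /freq -mulrDl -natrD -count_predUI; congr (_%:R / _).
rewrite (@eq_count _ (predI _ _) pred0) ?count_pred0 ?addn0.
  apply: eq_count => y /=; apply/idP/idP => [/asboolP[] h|/orP[] /asboolP h].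
  - by apply/orP; left; apply/asboolP.
  - by apply/orP; right; apply/asboolP.
  - by apply/asboolP; left.
  - by apply/asboolP; right.
move=> y /=; apply/negbTE/negP => /andP[/asboolP a /asboolP b].
by have : (A `&` B) y by []; rewrite AB.
Qed.

Lemma freqT O : O <> [::] -> freq O setT = 1.
Proof.
case: O => // y O _; rewrite /freq (@eq_count _ _ predT) ?count_predT.
  by rewrite divff // pnatr_eq0.
by move=> z /=; apply/asboolP.
Qed.

Lemma freq_perm O s Y : perm_eq (map s O) O -> freq O (s @^-1` Y) = freq O Y.
Proof. by move=> /permP /(_ (fun y => `[< Y y >])); rewrite count_map /freq => <-. Qed.

(** The section filter of the directed set of finite subsets of [G]: along it a list eventually
    contains any given element. *)
Definition cofinal_lists : set_system (seq (bits -> bits)) :=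
  [set P | exists2 S0 : seq (bits -> bits), (forall s, s \in S0 -> G s) &
    forall S, (forall s, s \in S -> G s) -> {subset S0 <= S} -> P S].

Lemma cofinal_lists_filter : ProperFilter cofinal_lists.
Proof.
split.
  by move=> [S0 GS0 H]; exact: (H S0).
split.
- by exists [::].
- move=> P Q [S1 G1 H1] [S2 G2 H2]; exists (S1 ++ S2).
    by move=> s; rewrite mem_cat => /orP[/G1|/G2].
  move=> S GS sub; split; [apply: H1|apply: H2] => // s sS; apply: sub;
    by rewrite mem_cat sS ?orbT.
- by move=> P Q PQ [S0 GS0 H]; exists S0 => // S GS sub; apply: PQ; exact: H.
Qed.

(** [m] is the limit of the frequencies on the finite orbits [Q S] along an ultrafilter refining
    [cofinal_lists]. Invariance under [h] holds for every [S] containing [h], hence in the limit. *)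
Theorem invariant_mean : exists m : set bits -> R,
  [/\ forall Y, 0 <= m Y, m setT = 1,
      forall A B, A `&` B = set0 -> m (A `|` B) = m A + m B &
      forall h Y, G h -> m (h @^-1` Y) = m Y].
Proof.
have /choice[Q hO] (S : seq (bits -> bits)) : exists O : seq bits, (forall s, s \in S -> G s) ->
    [/\ uniq O, O <> [::] & forall s, s \in S -> perm_eq (map s O) O].
  case: (pselect (forall s, s \in S -> G s)) => [/invariant_orbit[Q h]|]; first by exists Q.
  by exists [::].
have [U [UU FU]] := ultraFilterLemma cofinal_lists_filter.
have /choice[m hm] (Y : set bits) : exists p : R,
    [set` `[0, 1]] p /\ (freq (Q S) Y @[S --> U] --> p).
  have := @segment_compact R 0 1; rewrite compact_ultra => /(_ (fmap (fun S => freq (Q S) Y) U)).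
  move=> /(_ _ _)[||p [p01 cp]]; [exact: ultra_fmap|..|by exists p].
  by apply: (@filterS _ U _ setT) filterT => S _ /=; rewrite in_itv /= freq_ge0 freq_le1.
have PU : ProperFilter U by exact: ultra_proper.
have large (P : set (seq (bits -> bits))) (h : bits -> bits) : G h ->
    (forall S, (forall s, s \in S -> G s) -> h \in S -> P S) -> U P.
  move=> Gh H; apply: FU; exists [:: h]; first by move=> s; rewrite inE => /eqP ->.
  by move=> S GS sub; apply: H => //; apply: sub; rewrite inE.
exists m; split.
- by move=> Y; have [] := hm Y; rewrite /= in_itv /= => /andP[].
- apply: (cvg_unique _ (hm setT).2); first exact: Rhausdorff.
  have c1 : (1 : R) @[S --> U] --> (1 : R) by exact: cvg_cst.
  apply: cvg_trans c1; apply: near_eq_cvg; apply: FU; exists [::] => // S GS _.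
  by have [_ O0 _] := hO S GS; rewrite freqT.
- move=> A B AB; apply: (cvg_unique _ (hm (A `|` B)).2); first exact: Rhausdorff.
  have c : freq (Q S) A + freq (Q S) B @[S --> U] --> m A + m B.
    exact: cvgD (hm A).2 (hm B).2.
  apply: cvg_trans c; apply: near_eq_cvg.
  by apply: nearW => S /=; rewrite freqU.
- move=> h Y Gh; apply: (cvg_unique _ (hm (h @^-1` Y)).2); first exact: Rhausdorff.
  apply: cvg_trans (hm Y).2; apply: near_eq_cvg; apply: (large _ h Gh) => S GS hS.
  by have [_ _ P] := hO S GS; rewrite /= freq_perm //; exact: P.
Qed.

End InvariantMean.

(** * From a finitely additive mean to a Borel probability *)

Lemma pushforward_measure_ex d d' (T : measurableType d) (T' : measurableType d')
    (R : realType) (m : {measure set T -> \bar R}) (f : T -> T') :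
  measurable_fun setT f ->
  exists nu : {measure set T' -> \bar R}, forall B, nu B = m (f @^-1` B).
Proof. by move=> mf; unshelve eexists (pushforward m f). Qed.

Lemma probability_ex d (T : measurableType d) (R : realType)
    (m : {measure set T -> \bar R}) : m setT = 1%E ->
  exists nu : probability T R, forall B, nu B = m B.
Proof.
move=> h; exists (mnormalize m (dirac point)) => B /=.
by rewrite /mnormalize h onee_eq0 /= invr1 mule1.
Qed.

Definition cyl (v : seq bool) : set bits := [set x | pre (size v) x = v].

Lemma cyl_nil : cyl [::] = setT.
Proof. by apply/seteqP; split. Qed.

Lemma cyl_split v : cyl v = cyl (rcons v false) `|` cyl (rcons v true).
Proof.
apply/seteqP; split=> x; rewrite /cyl /= !size_rcons !preS.
  by move=> ->; case: (x (size v)); [right|left].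
by case=> /rcons_inj[].
Qed.

Lemma cyl_disj v : cyl (rcons v false) `&` cyl (rcons v true) = set0.
Proof.
apply/seteqP; split=> // x []; rewrite /cyl /= !size_rcons !preS.
by move=> /rcons_inj[_ ->] /rcons_inj[].
Qed.

Section MeasureOfMean.
Context {R : realType}.
Variable m : set bits -> R.
Hypothesis m_ge0 : forall Y, 0 <= m Y.
Hypothesis mT : m setT = 1.
Hypothesis mU : forall A B, A `&` B = set0 -> m (A `|` B) = m A + m B.

Lemma m_split v : m (cyl v) = m (cyl (rcons v false)) + m (cyl (rcons v true)).
Proof. by rewrite {1}cyl_split mU // cyl_disj. Qed.

(* The interval [[lo v, lo v + m (cyl v)[] is assigned to the cylinder [cyl v],
   in lexicographic order; [bisect t n] is the [v] of length [n] whose interval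
   contains [t]. *)
Fixpoint lo_rev (v : seq bool) : R :=
  if v is b :: w then
    lo_rev w + (if b then m (cyl (rcons (rev w) false)) else 0)
  else 0.

Definition lo (v : seq bool) : R := lo_rev (rev v).

Lemma lo_rcons v b : lo (rcons v b) = lo v + (if b then m (cyl (rcons v false)) else 0).
Proof. by rewrite /lo rev_rcons /= revK. Qed.

Fixpoint bisect (t : R) (n : nat) : seq bool :=
  if n is k.+1 then
    let v := bisect t k in rcons v (lo v + m (cyl (rcons v false)) <= t)
  else [::].

(** The inverse distribution function: it carries Lebesgue measure on [[0, 1[] to a measure giving
    each cylinder the mass prescribed by [m]. *)
Definition quantile (t : R) : bits := fun n => last false (bisect t n.+1).

Lemma pre_quantile t n : pre n (quantile t) = bisect t n.
Proof. by elim: n => // n IH; rewrite preS IH /quantile /= last_rcons. Qed.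

Lemma bisectE t v : 0 <= t < 1 ->
  (bisect t (size v) == v) = (lo v <= t < lo v + m (cyl v)).
Proof.
move=> t01; elim/last_ind: v => [|v b IH]; first by rewrite cyl_nil mT /lo /= add0r t01.
rewrite size_rcons /= lo_rcons eqseq_rcons.
have ms := m_split v; have p0 := m_ge0 (cyl (rcons v false)).
have p1 := m_ge0 (cyl (rcons v true)).
have [E|nE] := eqVneq (bisect t (size v)) v.
  rewrite E; move: IH; rewrite E eqxx => /esym/andP[h1 h2] /=.
  case: b => /=.
    by rewrite eqb_id (_ : t < _ = true) ?andbT // -addrA -ms.
  by rewrite eqbF_neg -ltNge addr0 h1.
move: IH; rewrite (negbTE nE) /= => /esym/negbT IH; apply/esym/negbTE/negP => /andP[h1 h2].
by move/negP: IH; apply; apply/andP; move: h1 h2; case: b; split; lra.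
Qed.

Lemma lo_bounds v : 0 <= lo v /\ lo v + m (cyl v) <= 1.
Proof.
elim/last_ind: v => [|v b [h1 h2]]; first by rewrite cyl_nil mT /lo /= add0r lexx.
have ms := m_split v; have p0 := m_ge0 (cyl (rcons v false)).
have p1 := m_ge0 (cyl (rcons v true)).
by rewrite lo_rcons; case: b; split; lra.
Qed.

Lemma measurable_bisect v : measurable [set t : R | bisect t (size v) = v].
Proof.
elim/last_ind: v => [|v b IH]; first by rewrite (_ : [set t | _] = setT) //; apply/seteqP.
pose c := lo v + m (cyl (rcons v false)).
have -> : [set t | bisect t (size (rcons v b)) = rcons v b] =
    [set t | bisect t (size v) = v] `&` (if b then `[c, +oo[%classic else `]-oo, c[%classic).
  rewrite size_rcons; apply/seteqP; split=> t /=.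
    move=> /rcons_inj[E]; rewrite E -/c => Eb; split=> //; rewrite -Eb.
    by case: (leP c t) => h; rewrite /= in_itv /= ?andbT.
  move=> [E]; rewrite E -/c => h; congr rcons; case: b h; rewrite /= in_itv /= ?andbT => h.
    by rewrite h.
  by apply/negbTE; rewrite -ltNge.
by apply: measurableI => //; case: b; exact: measurable_itv.
Qed.

Section Coded.
Context {T : topologicalType}.
Variables (x0 : T) (kap : bits -> T) (kap' : T -> bits).
Hypotheses (kapK : cancel kap kap') (kap'K : cancel kap' kap).
Hypothesis cyl_open : forall v, open (kap' @^-1` cyl v).
Hypothesis kap_cont : forall (O : set T) x, open O -> O (kap x) ->
  exists n, forall y, pre n y = pre n x -> O (kap y).

Definition cyls : set (set (borel x0)) :=
  [set A | A = set0 \/ exists v, A = kap' @^-1` cyl v].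

(** Every open set is the union of the countably many cylinders that it contains. *)
Lemma borel_cylsE : @measurable _ (borel x0) = <<s cyls >>.
Proof.
apply/seteqP; split; last first.
  apply: smallest_sub; first exact: sigma_algebra_measurable.
  move=> A [->|[v ->]]; first exact: measurable0.
  by apply: sub_sigma_algebra; exact: cyl_open.
apply: smallest_sub; first exact: smallest_sigma_algebra.
move=> O oO.
have -> : O = \bigcup_n (\bigcup_(v in [set v | v \in verts n /\ kap' @^-1` cyl v `<=` O])
    (kap' @^-1` cyl v)).
  apply/seteqP; split=> [t Ot|t [n _ [v [_ h] /h]] //].
  rewrite -(kap'K t) in Ot; have [n hn] := kap_cont oO Ot.
  exists n => //; exists (pre n (kap' t)); last by rewrite /cyl /= size_pre.
  split; first exact: verts_pre.
  by move=> u; rewrite /cyl /= size_pre => /hn; rewrite kap'K.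
pose gT := g_sigma_algebraType cyls.
suff : @measurable _ gT (\bigcup_n (\bigcup_(v in [set v | v \in verts n /\ kap' @^-1` cyl v `<=` O])
    (kap' @^-1` cyl v : set gT))) by [].
apply: bigcupT_measurable => n; apply: fin_bigcup_measurable.
  by apply: (@sub_finite_set _ _ [set` verts n]) => // v [].
by move=> v _; apply: sub_sigma_algebra; right; exists v.
Qed.

Lemma cyls_setI : setI_closed cyls.
Proof.
have nested (v w : seq bool) : (size v <= size w)%N ->
    cyls (kap' @^-1` cyl v `&` kap' @^-1` cyl w).
  move=> le; have [E|E] := eqVneq (take (size v) w) v; [right; exists w|left];
    apply/seteqP; split=> t //.
  - by move=> [].
  - move=> tw; split=> //; rewrite /cyl /= -{2}E -tw pre_take //.
  - by move=> [tv tw]; move/eqP: E; apply; rewrite -[in LHS]tw -[in RHS]tv pre_take.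
move=> _ _ [->|[v ->]] [->|[w ->]]; rewrite ?set0I ?setI0; try by left.
by case: (leqP (size v) (size w)) => [/nested//|/ltnW/nested]; rewrite setIC.
Qed.

Lemma measurable_quantile : measurable_fun setT (kap \o quantile : R -> borel x0).
Proof.
apply: (measurability cyls); first exact: borel_cylsE.
move=> _ [_ [->|[v ->]] <-]; first by rewrite preimage_set0 setI0.
rewrite setTI (_ : _ @^-1` _ = [set t | bisect t (size v) = v]).
  exact: measurable_bisect.
by apply/seteqP; split=> t; rewrite /cyl /= kapK pre_quantile.
Qed.

Definition clopen_bits (Y : set bits) : Prop :=
  exists n, forall x y, pre n x = pre n y -> Y x -> Y y.

(** The image of Lebesgue measure under [kap \o quantile] agrees with [m] on cylinders, hence on
    clopen sets, their finite disjoint unions; [m] is only finitely additive and may differ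
    elsewhere. *)
Lemma borel_measure_ex : exists mu : probability (borel x0) R,
  forall Y, clopen_bits Y -> mu (kap' @^-1` Y) = (m Y)%:E.
Proof.
pose leb := @lebesgue_measure R.
have [nu hnu] := pushforward_measure_ex
  (mrestr leb (measurable_itv `[(0 : R), 1[)) measurable_quantile.
have nuE v : nu (kap' @^-1` cyl v) = (m (cyl v))%:E.
  rewrite hnu.
  change (leb ((kap \o quantile) @^-1` (kap' @^-1` cyl v) `&` [set` `[0, 1[]) = (m (cyl v))%:E).
  have -> : (kap \o quantile) @^-1` (kap' @^-1` cyl v) `&` [set` `[0, 1[] =
      [set` `[lo v, lo v + m (cyl v)[].
    apply/seteqP; split=> t; rewrite /= !in_itv /= kapK /cyl /= pre_quantile.
      by move=> [E t01]; rewrite -bisectE // E.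
    move=> h; have t01 : 0 <= t < 1.
      by have [l0 l1] := lo_bounds v; move/andP: h => [h1 h2]; apply/andP; split; lra.
    by split=> //; apply/eqP; rewrite bisectE.
  rewrite /leb lebesgue_measure_itv /= lte_fin ltrDl.
  case: ltP => c; first by rewrite -EFinB addrAC subrr add0r.
  by congr _%:E; apply/eqP; rewrite eq_le c m_ge0.
have [|mu hmu] := probability_ex (m := nu).
  have := nuE [::]; rewrite cyl_nil preimage_setT => ->; by rewrite mT.
exists mu => Y [n hY]; rewrite hmu.
suff H k v : (size v + k = n)%N -> measurable (kap' @^-1` (Y `&` cyl v) : set (borel x0)) /\
    nu (kap' @^-1` (Y `&` cyl v)) = (m (Y `&` cyl v))%:E.
  by have [_] := H n [::] erefl; rewrite cyl_nil setIT.
elim: k v => [|k IH] v sv.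
  have [E|/set0P[x [Yx vx]]] := eqVneq (Y `&` cyl v) set0.
    rewrite E preimage_set0 measure0; split=> //; congr _%:E.
    by have := mU (setI0 set0); rewrite setU0 => h; lra.
  have -> : Y `&` cyl v = cyl v.
    apply/seteqP; split=> [y []|y vy] //; split=> //; apply: hY Yx.
    by rewrite -sv addn0 vx vy.
  split; last exact: nuE.
  by rewrite borel_cylsE; apply: sub_sigma_algebra; right; exists v.
have [|M1 N1] := IH (rcons v false); first by rewrite size_rcons addSn -addnS.
have [|M2 N2] := IH (rcons v true); first by rewrite size_rcons addSn -addnS.
have D : (Y `&` cyl (rcons v false)) `&` (Y `&` cyl (rcons v true)) = set0.
  by rewrite setIACA cyl_disj setI0.
rewrite cyl_split setIUr mU // preimage_setU; split; first exact: measurableU.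
rewrite measureU //; first exact: (congr2 adde N1 N2).
by rewrite -preimage_setI D preimage_set0.
Qed.

(** Cylinders generate the Borel sets and, with the empty set, are stable under intersection, so
    comparing [mu] with its image on them suffices. Their preimages are clopen, where [mu] is given
    by the invariant [m]. *)
Lemma borel_measure_invariant (mu : probability (borel x0) R) (h : bits -> bits) :
  (forall Y, clopen_bits Y -> mu (kap' @^-1` Y) = (m Y)%:E) ->
  treelike h -> (forall Y, m (h @^-1` Y) = m Y) ->
  forall X : set (borel x0), measurable X -> mu ((kap \o h \o kap') @^-1` X) = mu X.
Proof.
move=> hmu th inv.
have clo Y : clopen_bits Y -> clopen_bits (h @^-1` Y).
  move=> [n hY]; have [k hk] := treelike_continuous n th.
  by exists k => x y /hk E; exact: hY.
have cloC v : clopen_bits (cyl v) by exists (size v) => x y; rewrite /cyl /= => ->.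
have preE Y : (kap \o h \o kap') @^-1` (kap' @^-1` Y) = kap' @^-1` (h @^-1` Y).
  by apply/seteqP; split=> t /=; rewrite kapK.
have mcl Y : clopen_bits Y -> measurable (kap' @^-1` Y : set (borel x0)).
  move=> [n hY]; have -> : Y = \bigcup_(v in [set v | v \in verts n /\ cyl v `<=` Y]) cyl v.
    apply/seteqP; split=> [x Yx|x [v [_ sub]] /sub //].
    exists (pre n x); last by rewrite /cyl /= size_pre.
    split; first exact: verts_pre.
    by move=> y; rewrite /cyl /= size_pre => E; apply: hY Yx.
  rewrite preimage_bigcup; apply: fin_bigcup_measurable.
    by apply: (@sub_finite_set _ _ [set` verts n]) => // v [].
  by move=> v _; rewrite borel_cylsE; apply: sub_sigma_algebra; right; exists v.
have mF : measurable_fun setT (kap \o h \o kap' : borel x0 -> borel x0).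
  apply: (measurability cyls); first exact: borel_cylsE.
  move=> _ [_ [->|[v ->]] <-]; first by rewrite preimage_set0 setI0.
  by rewrite setTI preE; exact: (mcl _ (clo _ (cloC v))).
have [nu hnu] := pushforward_measure_ex mu mF.
move=> X mX; rewrite -hnu.
have gT : \bigcup_(k : nat) ((fun=> setT) k : set (borel x0)) = setT.
  by apply/seteqP; split=> // t _; exists 0%N.
apply: (measure_unique cyls (fun=> setT) borel_cylsE cyls_setI _ gT nu mu _ _ X mX).
- by move=> _; right; exists [::]; rewrite cyl_nil preimage_setT.
- move=> A [->|[v ->]]; first by rewrite !measure0.
  have e1 := hmu _ (clo _ (cloC v)); have e2 := hmu _ (cloC v); rewrite inv in e1.
  rewrite hnu; exact: (etrans (etrans (congr1 mu (preE _)) e1) (esym e2)).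
- have nT : nu setT = 1%E by apply: etrans (hnu setT) _; exact: (@probability_setT _ _ _ mu).
  by move=> _; rewrite nT ltry.
Qed.

End Coded.
End MeasureOfMean.

(** * Action of the mapping class group *)

Section MappingClasses.
Context {R : realType} {S : surface R}.
Variable lam : R.
Hypothesis hlam : 0 < lam < 1 / 2%:R.
Variable g : R -> S.
Hypothesis hg : smooth_segment g.

Let K : set S := g @` cantor lam.
Let pt : bits -> S := point_of lam g.

Let pt_inj : injective pt. Proof. exact: (point_of_inj hlam hg). Qed.

Let ptK x : K (pt x).
Proof. by rewrite /K (cantor_imageE hlam); exists x. Qed.

Let Kpt p : K p -> exists x, pt x = p.
Proof. by rewrite /K (cantor_imageE hlam) => -[x _ <-]; exists x. Qed.

Lemma Diff_id (A : set S) : Diff A (smooth_id S).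
Proof.
split; first by exists (smooth_id S).
  by move=> c d Ac Ad x cx dx; exact: (atlas_oriented Ac Ad cx dx).
by apply/seteqP; split=> [_ [p Ap <-]|p Ap] //; exists p.
Qed.

Lemma Diff0_id (A : set S) : Diff0 A (smooth_id S).
Proof. by apply: connected_component_refl; exact: Diff_id. Qed.

Lemma mcg_nonempty A : mcg K A -> exists f, A f.
Proof. by move=> [f Df <-]; exists f, f, (smooth_id S); split=> //; exact: Diff0_id. Qed.

Lemma Diff_act f : Diff K f -> exists h h', [/\ cancel h h', cancel h' h, treelike h &
  forall x, f (pt x) = pt (h x)].
Proof.
move=> [[f' [fK f'K]] _ fKK].
have /choice[h hh] x : exists y, f (pt x) = pt y.
  have : [set f p | p in K] (f (pt x)) by exists (pt x).
  by rewrite fKK => /Kpt[y <-]; exists y.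
have /choice[h' hh'] x : exists y, f' (pt x) = pt y.
  have := ptK x; rewrite -{1}fKK => -[p /Kpt[y <-] <-].
  by exists y; rewrite fK.
have hK : cancel h h' by move=> x; apply: pt_inj; rewrite -hh' -hh fK.
have h'K : cancel h' h by move=> x; apply: pt_inj; rewrite -hh -hh' f'K.
exists h, h'; split=> //.
apply: (strict_diff_treelike hlam hK h'K).
- exact: (induced_continuous hlam hg hh).
- exact: (induced_continuous hlam hg hh').
- exact: (induced_strict hlam hg hh).
- exact: (induced_strict hlam hg hh').
Qed.

(** All representatives of a class induce the same map, as [Diff0] fixes the Cantor set
    pointwise. *)
Lemma mcg_act A : mcg K A -> exists h h', [/\ cancel h h', cancel h' h, treelike h &
  forall f, A f -> forall x, f (pt x) = pt (h x)].
Proof.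
move=> [f Df <-]; have [h [h' [hK h'K th fh]]] := Diff_act Df.
exists h, h'; split=> // f2 [f1 [d [-> dD E]]] x.
by rewrite E /= (Diff0_fixes hlam hg _ dD) fh.
Qed.

Variable Gamma : set (set (smooth_map S S)).
Hypothesis hGamma : mcg_subgroup K Gamma.

Definition induced_group : set (bits -> bits) :=
  [set h | exists2 A, Gamma A & forall f, A f -> forall x, f (pt x) = pt (h x)].

Lemma induced_group_act A : Gamma A -> exists2 h, induced_group h &
  forall f, A f -> forall x, f (pt x) = pt (h x).
Proof.
case: hGamma => sub _ _ _ GA; have [h [_ [_ _ _ hA]]] := mcg_act (sub _ GA).
by exists h => //; exists A.
Qed.

Lemma setinv_act (A : set (smooth_map S S)) a a' : cancel a a' -> cancel a' a ->
  (forall f : smooth_map S S, A f -> forall x, f (pt x) = pt (a x)) ->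
  forall f, setinv A f -> forall x, f (pt x) = pt (a' x).
Proof.
move=> aK a'K hA f [f' Af' [f'K _]] x.
by rewrite -{1}(a'K x) -(hA _ Af') f'K.
Qed.

Lemma induced_map_group : map_group induced_group.
Proof.
case: (hGamma) => sub G0 Gc Gi; split.
- by exists (Diff0 K) => // f Df x; exact: Diff0_fixes.
- move=> h k [A GA hA] [B GB hB]; exists (setcomp B A); first exact: Gc.
  by move=> _ [f1 [f2 [Bf1 Af2 ->]]] x; rewrite /= (hA _ Af2) (hB _ Bf1).
- move=> h [A GA hA]; have [h1 [h' [hK h'K _ hA1]]] := mcg_act (sub _ GA).
  have [f Af] := mcg_nonempty (sub _ GA).
  have E : h1 = h by apply/funext => x; apply: pt_inj; rewrite -(hA _ Af) -(hA1 _ Af).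
  rewrite {}E in hK h'K; exists h'; split=> //; exists (setinv A); first exact: Gi.
  exact: (setinv_act hK h'K hA).
- move=> h [A GA hA]; have [h1 [h' [_ _ th hA1]]] := mcg_act (sub _ GA).
  have [f Af] := mcg_nonempty (sub _ GA).
  suff <- : h1 = h by [].
  by apply/funext => x; apply: pt_inj; rewrite -(hA _ Af) -(hA1 _ Af).
Qed.

Lemma eval_word_act (A B : set (smooth_map S S)) a a' b b' w : cancel a a' -> cancel a' a -> cancel b b' ->
  cancel b' b -> (forall f, A f -> forall x, f (pt x) = pt (a x)) ->
  (forall f, B f -> forall x, f (pt x) = pt (b x)) ->
  forall f, eval_word K A B w f -> forall x, f (pt x) = pt (evalw a a' b b' w x).
Proof.
move=> aK a'K bK b'K hA hB; elim: w => [|l w IH] f /=.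
  by move=> Df x; exact: Diff0_fixes.
move=> [f1 [f2 [L1 W2 ->]]] x; rewrite /= (IH _ W2).
move: l L1 => [[] []]; rewrite /eval_letter /letter /=.
- by move=> /(setinv_act aK a'K hA).
- by move=> /hA.
- by move=> /(setinv_act bK b'K hB).
- by move=> /hB.
Qed.

(** A word representing the trivial class has the identity among its elements, so the corresponding
    map of sequences would fix every point. *)
Lemma contains_free_group2_of : acts_freely induced_group -> contains_free_group2 K Gamma.
Proof.
move=> [a [a' [b [b' [[[A GA hA] _ [B GB hB] _] [aK a'K bK b'K] fw]]]]].
exists A, B; split=> // w rw w0 E.
have [|z] := fw w rw; first exact/eqP.
apply; apply: pt_inj.
have := Diff0_id K; rewrite -E => /(eval_word_act aK a'K bK b'K hA hB).
by move=> /(_ z) /= <-.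
Qed.

Definition cantor_pt (x : bits) : K := exist _ (pt x) (mem_set (ptK x)).

Lemma has_invariant_probability_of :
  (forall T : seq (bits -> bits), (forall s, s \in T -> induced_group s) ->
     exists x (F : seq bits), forall h, gen T h -> h x \in F) ->
  has_invariant_probability K Gamma.
Proof.
move=> orb; have [id1 _ inv tl] := induced_map_group.
have injG h : induced_group h -> injective h.
  by move=> /inv[k [_ hK _]]; exact: can_inj hK.
have [m [m0 mT mU minv]] := @invariant_mean R _ injG orb.
have /choice[cd hcd] (t : K) : exists x, pt x = val t by exact/Kpt/set_mem/(valP t).
have cK : cancel cantor_pt cd by move=> x; apply: pt_inj; rewrite hcd.
have cdK : cancel cd cantor_pt by move=> t; apply: val_inj; rewrite /= hcd.
have copen v : open (cd @^-1` cyl v).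
  pose x := catb v (fun=> false).
  have [V oV hV] := point_of_open hlam hg (size v) x.
  exists V => //; apply/seteqP; split=> t Vt.
    have : V (pt (cd t)) by rewrite hcd.
    by move=> /hV; rewrite /cyl /= pre_catb.
  have : V (pt (cd t)) by apply/hV; rewrite pre_catb.
  by rewrite hcd.
have ccont (V : set K) x : open V -> V (cantor_pt x) ->
    exists n, forall y, pre n y = pre n x -> V (cantor_pt y).
  move=> [W oW <-] Wx.
  by have [n hn] := point_of_near hlam hg (open_nbhs_nbhs (conj oW Wx)); exists n.
pose x0 := cantor_pt (fun=> false).
have [mu hmu] := borel_measure_ex m0 mT mU x0 cK cdK copen ccont.
exists x0, mu => A GA f Af X mX.
have [h hh hA] := induced_group_act GA.
rewrite -[RHS](borel_measure_invariant cK cdK copen ccont hmu (tl _ hh) _ mX).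
  congr (mu _); apply/seteqP; split=> t /=.
    move=> [u E Xu]; rewrite (_ : cantor_pt _ = u) //; apply: val_inj.
    by rewrite /= -(hA _ Af) hcd.
  by move=> Xt; exists (cantor_pt (h (cd t))) => //=; rewrite -(hA _ Af) hcd.
by move=> Y; exact: minv.
Qed.

End MappingClasses.

Theorem corollary1p4 (R : realType) (S : surface R) (hS : finite_type S)
  (lam : R) (hlam : 0 < lam < 1 / 2%:R)
  (g : R -> S) (hg : smooth_segment g)
  (Gamma : set (set (smooth_map S S)))
  (hGamma : mcg_subgroup (g @` cantor lam) Gamma) :
  contains_free_group2 (g @` cantor lam) Gamma \/
  has_invariant_probability (g @` cantor lam) Gamma.
Proof.
case: (free_or_finite_orbit (induced_map_group hlam hg hGamma)).
  by move=> fr; left; exact: (contains_free_group2_of hlam hg fr).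
by move=> orb; right; exact: (has_invariant_probability_of hlam hg hGamma orb).
Qed.
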